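(* Let $\mathbf{c}=(c_1,\dots,c_m)$ be a vector of positive integers with sum $c=\sum_i c_i$ and let $g\ge 0$ be an integer. The territory $\mathrm{Ter}^g_{\mathbf{c}}$ contains a (possibly empty) closed subscheme $\mathrm{Spine}(g,\mathbf{c})$ (its spine, as defined in the context) which is isomorphic to the Grassmannian $\mathrm{Gr}\!\left(c-m-g,\ \sum_{i=1}^m\lfloor \tfrac{c_i}{2}\rfloor\right)$.
   Context: For a vector $\mathbf{c}=(c_1,\dots,c_m)$ of positive integers let $A^+_{\mathbf{c}}=\mathbb{Z}[t_1,\dots,t_m]/(t_i^{c_i},\ t_it_j : i\neq j)$, a free $\mathbb{Z}$-module of rank $c-m+1$ with basis $1$ and $t_i^j$ ($1\le i\le m$, $1\le j<c_i$). For a scheme $S$ and a finite locally free $\mathcal{O}_S$-algebra $\mathscr{A}$, the territory $\mathrm{Ter}^g_{\mathscr{A}}$ is the $S$-scheme representing the functor sending $f:T\to S$ to the set of quasi-coherent $\mathcal{O}_T$-subalgebras $\mathscr{B}\subseteq f^*\mathscr{A}$ such that $f^*\mathscr{A}/\mathscr{B}$ is locally free of rank $g$ (a closed subscheme of a Grassmannian of $\mathscr{A}$; empty if $g<0$). Write $\mathrm{Ter}^g_{\mathbf{c}}=\mathrm{Ter}^g_{A^+_{\mathbf{c}}}$, a scheme over $\operatorname{Spec}\mathbb{Z}$. Let $A^{spine}_{\mathbf{c}}=\mathbb{Z}+(t_i^{\lceil c_i/2\rceil}: i=1,\dots,m)\subseteq A^+_{\mathbf{c}}$, and let $\delta$ be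 its corank in $A^+_{\mathbf{c}}$. The spine $\mathrm{Spine}(g,\mathbf{c})$ is $\mathrm{Ter}^{g-\delta}_{A^{spine}_{\mathbf{c}}}$, viewed inside $\mathrm{Ter}^g_{\mathbf{c}}$ by regarding a subalgebra of $A^{spine}_{\mathbf{c}}$ as a subalgebra of $A^+_{\mathbf{c}}$. $\mathrm{Gr}(r,N)$ denotes the Grassmannian over $\mathbb{Z}$ of rank $r$ subbundles (with locally free quotient) of the trivial bundle of rank $N$; it is empty if $r<0$ or $r>N$. *)

(* Defs.v *)
From HB Require Import structures.
From mathcomp Require Import all_boot all_order all_algebra.
From mathcomp Require Import boolp classical_sets functions.

Set Implicit Arguments.
Unset Strict Implicit.
Unset Printing Implicit Defensive.

Import GRing.Theory.
Local Open Scope classical_set_scope.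
Local Open Scope ring_scope.

(* A scheme over Z is handled through its functor of points on affine         *)
(* schemes: R |-> X(Spec R), for R ranging over all commutative rings, the    *)
(* zero ring included (hence comPzRingType).  By Yoneda, morphisms of schemes *)
(* are natural transformations, and a closed immersion is a subfunctor which  *)
(* is cut out, on every Spec R -> X, by an ideal of R.                        *)
(*                                                                            *)
(* All functors below are functors of submodules of a trivial bundle: a       *)
(* Spec R-point is a submodule of R^I, and pullback along phi : R -> S sends  *)
(* B to the image of S (x)_R B in S^I, i.e., the S-span of phi(B).            *)

Section Submodules.
Variables (R : comPzRingType) (V : lmodType R).

Definition is_submodule (B : set V) : Prop :=
  B 0 /\ forall (a : R) (u v : V), B u -> B v -> B (a *: u + v).

Definition span (X : set V) : set V :=
  [set v | exists (n : nat) (a : 'I_n -> R) (x : 'I_n -> V),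
     (forall k, X (x k)) /\ v = \sum_k a k *: x k].

(* for submodules B `<=` M, the R-module M / B is free of rank q *)
Definition free_quotient (M B : set V) (q : nat) : Prop :=
  exists e : 'I_q -> V, (forall k, M (e k)) /\
    forall v, M v -> exists! x : {ffun 'I_q -> R}, B (v - \sum_k x k *: e k).

End Submodules.

Definition is_ideal (R : comPzRingType) (I : set R) : Prop :=
  @is_submodule R R^o I.

Notation "''Mod[' R ]_ I" := {ffun I -> R^o}
  (at level 8, I at level 2, format "''Mod[' R ]_ I") : type_scope.

Section BaseChange.
Variables (I : finType) (R S : comPzRingType) (phi : {rmorphism R -> S}).

Definition map_vec (v : 'Mod[R]_I) : 'Mod[S]_I := [ffun i => phi (v i)].

Definition base_change (B : set 'Mod[R]_I) : set 'Mod[S]_I :=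
  span (map_vec @` B).

(* phi exhibits S as the localization R[1/f] *)
Definition is_localization (f : R) : Prop :=
  [/\ exists y, phi f * y = 1,
      forall s, exists (r : R) (n : nat), phi f ^+ n * s = phi r &
      forall r, phi r = 0 -> exists n : nat, f ^+ n * r = 0].

End BaseChange.

(* M / B is locally free with local ranks in rk: Spec R is covered by basic   *)
(* opens D(f_k) on which (M / B)[1/f_k] = M[1/f_k] / B[1/f_k] is free         *)
Definition locally_free_quotient_in (I : finType) (R : comPzRingType)
    (M B : set 'Mod[R]_I) (rk : set nat) : Prop :=
  exists (n : nat) (f : 'I_n -> R),
    (exists a : 'I_n -> R, \sum_k a k * f k = 1) /\
    forall k, exists (S : comPzRingType) (phi : {rmorphism R -> S}),
      is_localization phi (f k) /\
      exists2 q, rk q & free_quotient (base_change phi M) (base_change phi B) q.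

(* A negative rank r is only possible over the zero ring.                     *)
Definition locally_free_quotient (I : finType) (R : comPzRingType)
    (M B : set 'Mod[R]_I) (r : int) : Prop :=
  locally_free_quotient_in M B [set q : nat | q%:Z = r].

Section FunctorsOfSubmodules.

Definition submodule_points (I : finType) : Type :=
  forall R : comPzRingType, set (set 'Mod[R]_I).

Definition is_functor (I : finType) (X : submodule_points I) : Prop :=
  forall (R S : comPzRingType) (phi : {rmorphism R -> S}) B,
    X R B -> X S (base_change phi B).

(* J is the ideal of the pullback of Y along the point B : Spec R -> X        *)
Definition closed_subscheme (I : finType) (Y X : submodule_points I) : Prop :=
  [/\ is_functor X, is_functor Y, forall R, Y R `<=` X R &
      forall (R : comPzRingType) (B : set 'Mod[R]_I), X R B ->
        exists J : set R, is_ideal J /\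
          forall (S : comPzRingType) (phi : {rmorphism R -> S}),
            Y S (base_change phi B) <-> forall x, J x -> phi x = 0].

Definition isomorphic_schemes (I I' : finType)
    (X : submodule_points I) (X' : submodule_points I') : Prop :=
  [/\ is_functor X, is_functor X' &
      exists eta : forall R : comPzRingType, set 'Mod[R]_I -> set 'Mod[R]_I',
        (forall R, set_bij (X R) (X' R) (eta R)) /\
        forall (R S : comPzRingType) (phi : {rmorphism R -> S}) B, X R B ->
          eta S (base_change phi B) = base_change phi (eta R B)].

(* rank r subbundles, with locally free quotient, of the trivial bundle       *)
Definition Grassmannian (r : int) (N : nat) : submodule_points 'I_N :=
  fun R => [set V | [/\ is_submodule V, locally_free_quotient V [set 0] r &
                     locally_free_quotient_in setT V setT]].

End FunctorsOfSubmodules.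

Section Aplus.
Variables (m : nat) (c : 'I_m -> nat).

(* None stands for 1 and Some (Tagged i j) for t_i^(j+1), with j + 1 < c_i    *)
Definition Abasis : finType := option {i : 'I_m & 'I_(c i).-1}.

Definition Amon (i : 'I_m) (j : 'I_(c i).-1) : Abasis := Some (existT _ i j).

(* R[t_1..t_m] / (t_i^c_i, t_i t_j : i <> j) = R (x) A^+_c; see Agen_exp,     *)
(* Agen_mul and Aplus_expand below                                            *)
Definition Aplus (R : comPzRingType) : Type := 'Mod[R]_Abasis.

Section Ring.
Variable R : comPzRingType.
Implicit Types x y z : Aplus R.

HB.instance Definition _ := GRing.Lmodule.on (Aplus R).

(* coefficient of t_i^e *)
Definition Acoef x (i : 'I_m) (e : nat) : R :=
  if e is e'.+1 then
    if (insub e' : option 'I_(c i).-1) is Some j then x (Amon j) else 0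
  else x None.

Definition Amul x y : Aplus R :=
  [ffun b : Abasis => if b is Some (existT i j) then
               \sum_(a < j.+2) Acoef x i a * Acoef y i (j.+1 - a)
             else x None * y None].

Definition Aone : Aplus R := [ffun b : Abasis => (b == None)%:R].

Lemma AcoefP x y : x None = y None ->
  (forall i e, (e <= (c i).-1)%N -> Acoef x i e = Acoef y i e) -> x = y.
Proof.
move=> xy0 xyE; apply/ffunP => -[[i j]|//].
have := xyE i j.+1 (ltn_ord j); rewrite /Acoef; case: insubP => [k _ /val_inj|].
  by move->.
by rewrite ltn_ord.
Qed.

Lemma Acoef_mul x y i e : (e <= (c i).-1)%N ->
  Acoef (Amul x y) i e = \sum_(a < e.+1) Acoef x i a * Acoef y i (e - a).
Proof.
case: e => [|e] le_e; first by rewrite big_ord1 /= ffunE.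
by rewrite {1}/Acoef insubT ffunE.
Qed.

Lemma Acoef_mul_rev x y i e : (e <= (c i).-1)%N ->
  Acoef (Amul x y) i e = \sum_(a < e.+1) Acoef x i (e - a) * Acoef y i a.
Proof.
move=> le_e; rewrite Acoef_mul // (reindex_inj rev_ord_inj) /=.
by apply: eq_bigr => j _; rewrite (sub_ordK j).
Qed.

Lemma AcoefD x y i e : Acoef (x + y) i e = Acoef x i e + Acoef y i e.
Proof.
by case: e => [|e] /=; [|case: insub => [j|]]; rewrite ?ffunE ?addr0.
Qed.

Fact AmulA : associative Amul.
Proof.
move=> p q r; apply: AcoefP => [|i e le_e]; first by rewrite !ffunE mulrA.
rewrite Acoef_mul // Acoef_mul_rev //.
pose coef3 j k := Acoef p i j * (Acoef q i (e - j - k) * Acoef r i k).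
have le_sub j : (e - j <= (c i).-1)%N := leq_trans (leq_subr _ _) le_e.
transitivity (\sum_(j < e.+1) \sum_(k < e.+1 | (k <= e - j)%N) coef3 j k).
  apply: eq_bigr => /= j _; rewrite Acoef_mul_rev // big_distrr /=.
  by rewrite (big_ord_narrow_leq (leq_subr _ _)).
rewrite (exchange_big_dep predT) //=; apply: eq_bigr => k _.
transitivity (\sum_(j < e.+1 | (j <= e - k)%N) coef3 j k).
  apply: eq_bigl => j; rewrite -ltnS -(ltnS j) -!subSn ?leq_ord //.
  by rewrite -subn_gt0 -(subn_gt0 j) -!subnDA addnC.
rewrite (big_ord_narrow_leq (leq_subr _ _)) Acoef_mul // big_distrl /=.
by apply: eq_bigr => j _; rewrite /coef3 -!subnDA addnC mulrA.
Qed.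

Fact AmulC : commutative Amul.
Proof.
move=> x y; apply: AcoefP => [|i e le_e]; first by rewrite !ffunE mulrC.
by rewrite Acoef_mul // Acoef_mul_rev //; apply: eq_bigr => j _; rewrite mulrC.
Qed.

Lemma Acoef_one i e : Acoef Aone i e = (e == 0)%:R.
Proof. by case: e => [|e] /=; [|case: insub => [j|]]; rewrite ?ffunE. Qed.

Fact Amul1 : left_id Aone Amul.
Proof.
move=> x; apply: AcoefP => [|i e le_e]; first by rewrite !ffunE mul1r.
rewrite Acoef_mul // big_ord_recl Acoef_one mul1r subn0 big1 ?addr0 // => j _.
by rewrite Acoef_one mul0r.
Qed.

Fact AmulDl : left_distributive Amul +%R.
Proof.
move=> x y z; apply: AcoefP => [|i e le_e]; first by rewrite !ffunE mulrDl.
rewrite AcoefD !Acoef_mul // -big_split /=.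
by apply: eq_bigr => j _; rewrite AcoefD mulrDl.
Qed.

HB.instance Definition _ := GRing.Zmodule_isComPzRing.Build (Aplus R)
  AmulA AmulC Amul1 AmulDl.

Lemma AcoefM x y i e : (e <= (c i).-1)%N ->
  Acoef (x * y) i e = \sum_(a < e.+1) Acoef x i a * Acoef y i (e - a).
Proof. exact: Acoef_mul. Qed.

Lemma AmulNone x y : (x * y) None = x None * y None :> R.
Proof. by rewrite ffunE. Qed.

Lemma AcoefZ (a : R) x i e : Acoef (a *: x) i e = a * Acoef x i e.
Proof.
by case: e => [|e] /=; [|case: insub => [j|]]; rewrite ?ffunE ?mulr0.
Qed.

Lemma AscaleAl (a : R) x y : a *: (x * y) = a *: x * y.
Proof.
apply: AcoefP => [|i e le_e]; first by rewrite ffunE !AmulNone ffunE /GRing.scale /= mulrA.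
rewrite AcoefZ !AcoefM // big_distrr /=.
by apply: eq_bigr => j _; rewrite AcoefZ mulrA.
Qed.

(* the class of t_i, which is 0 if c_i = 1 *)
Definition Agen (i : 'I_m) : Aplus R :=
  [ffun b : Abasis => if b is Some (existT i' j) return R then
                        ((i' == i) && (val j == 0%N))%:R
                      else 0].

Lemma Acoef_gen i i' e : (e <= (c i').-1)%N ->
  Acoef (Agen i) i' e = ((i' == i) && (e == 1%N))%:R.
Proof.
case: e => [|e] le_e; first by rewrite andbF /= ffunE.
by rewrite /Acoef insubT ffunE.
Qed.

Lemma AgenX_None i e : (Agen i ^+ e.+1) None = 0.
Proof. by rewrite exprS AmulNone ffunE mul0r. Qed.

Lemma Acoef_genX i i' e k : (e <= (c i').-1)%N ->
  Acoef (Agen i ^+ k.+1) i' e = ((i' == i) && (e == k.+1))%:R.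
Proof.
elim: k e => [|k IHk] e le_e; first by rewrite expr1 Acoef_gen.
rewrite exprS AcoefM //; case: e le_e => [|e] le_e.
  by rewrite big_ord1 Acoef_gen // andbF mul0r.
have le1e : (1 <= (c i').-1)%N by apply: leq_trans le_e.
rewrite big_ord_recl big_ord_recl big1 => [|j _]; last first.
  rewrite Acoef_gen ?andbF ?mul0r //.
  by apply: leq_trans le_e; apply: (ltn_ord (lift ord0 (lift ord0 j))).
rewrite !Acoef_gen // !andbF mul0r add0r addr0 subSS subn0.
rewrite IHk; last exact: ltnW.
by rewrite andbT eqSS -natrM mulnb; case: (i' == i).
Qed.

Lemma Agen_exp i : (0 < c i)%N -> Agen i ^+ c i = 0.
Proof.
case ci: (c i) => [//|n] _; apply: AcoefP => [|i' e le_e].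
  by rewrite AgenX_None ffunE.
rewrite Acoef_genX //; have -> : Acoef (0 : Aplus R) i' e = 0.
  by case: (e) => [|k] /=; [|case: insub => [j|]]; rewrite ?ffunE.
case: eqP le_e => //= ->; rewrite ci /= => le_e.
by case: eqP le_e => // ->; rewrite ltnn.
Qed.

Lemma Agen_mul i i' : i != i' -> Agen i * Agen i' = 0.
Proof.
move=> ii'; apply: AcoefP => [|k e le_e].
  by rewrite AmulNone !ffunE mul0r.
have -> : Acoef (0 : Aplus R) k e = 0.
  by case: (e) => [|n] /=; [|case: insub => [j|]]; rewrite ?ffunE.
rewrite AcoefM // big1 // => a _.
rewrite !Acoef_gen; last 2 first.
- exact: leq_trans (leq_subr _ _) le_e.
- by apply: leq_trans le_e; rewrite -ltnS.
case: (k =P i) => [->|_]; last by rewrite mul0r.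
by rewrite (negPf ii') mulr0.
Qed.

Lemma Aplus_expand x :
  x = (x None : R) *: (1 : Aplus R) +
      \sum_i \sum_(j < (c i).-1) (x (Amon j) : R) *: Agen i ^+ j.+1.
Proof.
apply/ffunP => b; rewrite ffunE ffunE sum_ffunE.
under eq_bigr do rewrite sum_ffunE.
case: b => [[i j]|]; last first.
  rewrite ffunE big1 ?addr0; first by rewrite /GRing.scale /= mulr1.
  by move=> i _; rewrite big1 // => j _; rewrite ffunE AgenX_None scaler0.
have E i' k : (Agen i' ^+ k.+1) (Amon j) =
    ((i == i') && (j.+1 == k.+1))%:R.
  rewrite -(@Acoef_genX i' i j.+1 k) ?ltn_ord // /Acoef.
  by case: insubP => [l _ /val_inj ->|] //; rewrite ltn_ord.
rewrite ffunE scaler0 add0r (bigD1 i) //= (bigD1 j) //= ffunE E !eqxx.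
rewrite [X in _ + X]big1 => [|i' ni]; last first.
  by apply: big1 => k _; rewrite ffunE E eq_sym (negPf ni) scaler0.
rewrite big1 => [|k nk]; first by rewrite !addr0 /GRing.scale /= mulr1.
by rewrite ffunE E eqxx eqSS eq_sym val_eqE (negPf nk) scaler0.
Qed.

Definition is_subalgebra (B : set (Aplus R)) : Prop :=
  [/\ is_submodule B, B 1 & forall x y, B x -> B y -> B (x * y)].

End Ring.

(* Territory of a subring A' of A^+_c with A^+_c / A' free over Z, so that    *)
(* R (x) A' is the submodule base_change of A' in R (x) A^+_c.                *)
Definition territory (A' : set (Aplus int)) (g : int) : submodule_points Abasis :=
  fun R => let A'R := base_change (intmul (1 : R)) A' in
    [set B : set (Aplus R) |
      [/\ is_subalgebra B, B `<=` A'R & locally_free_quotient A'R B g]].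

Definition corank (A' : set (Aplus int)) : nat :=
  xget 0%N [set d | free_quotient setT A' d].

(* Z + (t_i^ceil(c_i/2) : i) *)
Definition Aspine : set (Aplus int) :=
  [set x | exists (n : int) (a : 'I_m -> Aplus int),
     x = n%:~R + \sum_i a i * Agen int i ^+ uphalf (c i)].

(* A subalgebra of R (x) A^spine is literally a subalgebra of R (x) A^+_c, so *)
(* that Spine is a family of subsets of Ter.                                  *)
Definition Ter (g : int) : submodule_points Abasis := territory setT g.

Definition Spine (g : int) : submodule_points Abasis :=
  territory Aspine (g - (corank Aspine)%:Z).

End Aplus.

Arguments Grassmannian r N R : clear implicits.
Arguments Ter {m} c g.
Arguments Spine {m} c g.

(* Main.v *)
(* If a, b >= c_i / 2 then t_i^a t_i^b = 0, so the elements of the spine       *)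
(* algebra without constant term have zero products: a subalgebra of           *)
(* R (x) A^spine is R 1 + V for an arbitrary submodule V of the free module    *)
(* R^N on the monomials t_i^j with ceil(c_i / 2) <= j < c_i, and the quotient  *)
(* by it is R^N / V.  A subalgebra B of R (x) A^+ is contained in              *)
(* R (x) A^spine iff its coordinates on the other monomials vanish; these      *)
(* coordinates generate the ideal that cuts out the spine.                     *)
(*   The rank conditions are compared by showing that the kernel of a          *)
(* surjection of locally free modules is locally free of the expected rank:    *)
(* if E P = 1, expanding det (E P) along the rows of P shows that the maximal  *)
(* minors of P generate the unit ideal, and where such a minor is invertible   *)
(* the kernel of P is a graph over the complementary coordinates.              *)

From HB Require Import structures.
From mathcomp Require Import all_boot all_order all_algebra.
From mathcomp Require Import perm boolp classical_sets functions ring zify.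
Require Import Defs.

Set Implicit Arguments.
Unset Strict Implicit.
Unset Printing Implicit Defensive.

Import GRing.Theory.
Local Open Scope classical_set_scope.
Local Open Scope ring_scope.

(** Write $x_0$ for the constant term of $x$. In the spine algebra $(x - x_0)(y - y_0) = 0$, because
    $t_i^a t_i^b = 0$ once $a, b \ge c_i/2$; this is [spine_mul]. Hence a submodule of $R \otimes
    A^{spine}$ containing $1$ is a subalgebra, and $V \mapsto R \cdot 1 \oplus V$ ([spine_of]) is a
    natural bijection from the submodules of $R^N$, where $N = \sum_i \lfloor c_i/2 \rfloor$ counts
    the tail monomials ([card_tail]). Both sides have the same quotient $R^N/V$
    ([free_quotient_spine_of]), and the count [card_spineC] gives $N - (c - m - g) = g - \delta$, so
    the rank conditions agree.

    Two facts about ranks remain. In [GrassmannianE], the rank of $V$ is traded for that of $R^N/V$;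
    in [Spine_closed], a point of the territory lying in $R \otimes A^{spine}$ must have corank $g -
    \delta$ there. Both follow from [locally_free_quotient_ker], on kernels of surjections of
    locally free modules.

    Local freeness is handled through [covered Q]: the elements $f$ such that $Q$ holds over every
    algebra inverting $f$ generate the unit ideal. In this form common refinements ([covered_and]),
    pullbacks ([covered_pull]) and covers of covers ([covered_trans]) become statements about
    ideals. *)

(** * Localization at an element *)

Module Localization.
Local Open Scope quotient_scope.
Section Localization.

Variables (R : comPzRingType) (f : R).
Implicit Types x y z : R * nat.

(* (r, n) stands for r / f ^ n *)
Definition equiv x y : bool :=
  `[< exists k : nat, f ^+ (k + y.2) * x.1 = f ^+ (k + x.2) * y.1 >].

Lemma equiv_refl : reflexive equiv.
Proof. by move=> x; apply/asboolP; exists 0%N. Qed.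

Lemma equiv_sym : symmetric equiv.
Proof.
by move=> x y; apply/asboolP/asboolP => -[k E]; exists k; rewrite E.
Qed.

Lemma equiv_trans : transitive equiv.
Proof.
move=> [y b] [x a] [z c] /asboolP[k /= E] /asboolP[l /= E'].
(* The exponent [b] of the middle fraction has to be absorbed as well. *)
apply/asboolP; exists (k + l + b)%N => /=.
have -> : f ^+ (k + l + b + c) * x = f ^+ (l + c) * (f ^+ (k + b) * x).
  by rewrite !exprD; ring.
rewrite E; transitivity (f ^+ (k + a) * (f ^+ (l + c) * y)).
  by rewrite !exprD; ring.
by rewrite E' !exprD; ring.
Qed.

Canonical equiv_equiv := EquivRel equiv equiv_refl equiv_sym equiv_trans.

Definition type := {eq_quot equiv}.

HB.instance Definition _ : EqQuotient _ equiv type := EqQuotient.on type.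
HB.instance Definition _ := Choice.on type.

Definition frac x : type := \pi_type x.

Lemma fracP x y :
  (exists k : nat, f ^+ (k + y.2) * x.1 = f ^+ (k + x.2) * y.1) <->
  frac x = frac y.
Proof.
split=> [E|/eqmodP/= /asboolP//].
by apply/eqmodP/asboolP.
Qed.

Lemma fracW (P : type -> Prop) : (forall r n, P (frac (r, n))) -> forall u, P u.
Proof. by move=> Pf u; rewrite -[u]reprK; case: (repr u). Qed.

Definition addf x y : R * nat :=
  (f ^+ y.2 * x.1 + f ^+ x.2 * y.1, (x.2 + y.2)%N).
Definition mulf x y : R * nat := (x.1 * y.1, (x.2 + y.2)%N).
Definition add (u v : type) : type := frac (addf (repr u) (repr v)).
Definition mul (u v : type) : type := frac (mulf (repr u) (repr v)).
Definition opp (u : type) : type := frac (- (repr u).1, (repr u).2).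

(** The operations are defined on representatives, and a representative is known only up to a power
    of $f$; this relation is what makes them well defined. *)
Lemma repr_frac x : exists k : nat,
  f ^+ (k + x.2) * (repr (frac x)).1 = f ^+ (k + (repr (frac x)).2) * x.1.
Proof. by apply/fracP; rewrite /frac reprK. Qed.

Lemma addE x y : add (frac x) (frac y) = frac (addf x y).
Proof.
have [k] := repr_frac x; have [l] := repr_frac y; rewrite /add.
case: (repr (frac x)) => r a; case: (repr (frac y)) => s b.
case: x y => [x n] [y m] /= Ey Ex.
apply/fracP; exists (k + l)%N => /=.
rewrite !mulrDr; congr (_ + _).
  transitivity (f ^+ (l + m + b) * (f ^+ (k + n) * r)); first by rewrite !exprD; ring.
  by rewrite Ex !exprD; ring.
transitivity (f ^+ (k + n + a) * (f ^+ (l + m) * s)); first by rewrite !exprD; ring.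
by rewrite Ey !exprD; ring.
Qed.

Lemma mulE x y : mul (frac x) (frac y) = frac (mulf x y).
Proof.
have [k] := repr_frac x; have [l] := repr_frac y; rewrite /mul.
case: (repr (frac x)) => r a; case: (repr (frac y)) => s b.
case: x y => [x n] [y m] /= Ey Ex.
apply/fracP; exists (k + l)%N => /=.
transitivity ((f ^+ (k + n) * r) * (f ^+ (l + m) * s)); first by rewrite !exprD; ring.
by rewrite Ex Ey !exprD; ring.
Qed.

Lemma oppE r n : opp (frac (r, n)) = frac (- r, n).
Proof.
have [k] := repr_frac (r, n); rewrite /opp; case: (repr _) => s a /= E.
by apply/fracP; exists k; rewrite /= !mulrN E.
Qed.

Fact addA : associative add.
Proof.
elim/fracW=> x n; elim/fracW=> y m; elim/fracW=> z p; rewrite !addE.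
by apply/fracP; exists 0%N; rewrite /addf /= !exprD; ring.
Qed.

Fact addC : commutative add.
Proof.
elim/fracW=> x n; elim/fracW=> y m; rewrite !addE.
by apply/fracP; exists 0%N; rewrite /addf /= !exprD; ring.
Qed.

Fact add0 : left_id (frac (0, 0%N)) add.
Proof.
elim/fracW=> x n; rewrite addE.
by apply/fracP; exists 0%N; rewrite /addf /= !exprD; ring.
Qed.

Fact addN : left_inverse (frac (0, 0%N)) opp add.
Proof.
elim/fracW=> x n; rewrite oppE addE.
by apply/fracP; exists 0%N; rewrite /addf /= !exprD; ring.
Qed.

HB.instance Definition _ := GRing.isZmodule.Build type addA addC add0 addN.

Fact mulA : associative mul.
Proof.
elim/fracW=> x n; elim/fracW=> y m; elim/fracW=> z p; rewrite !mulE.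
by apply/fracP; exists 0%N; rewrite /mulf /= !exprD; ring.
Qed.

Fact mulC : commutative mul.
Proof.
elim/fracW=> x n; elim/fracW=> y m; rewrite !mulE.
by apply/fracP; exists 0%N; rewrite /mulf /= !exprD; ring.
Qed.

Fact mul1 : left_id (frac (1, 0%N)) mul.
Proof.
elim/fracW=> x n; rewrite mulE.
by apply/fracP; exists 0%N; rewrite /mulf /= !exprD; ring.
Qed.

Fact mulDl : left_distributive mul add.
Proof.
elim/fracW=> x n; elim/fracW=> y m; elim/fracW=> z p; rewrite !(addE, mulE).
by apply/fracP; exists 0%N; rewrite /mulf /addf /= !exprD; ring.
Qed.

HB.instance Definition _ :=
  GRing.Zmodule_isComPzRing.Build type mulA mulC mul1 mulDl.

Definition inj (r : R) : type := frac (r, 0%N).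

Fact inj_zmod_morphism : zmod_morphism inj.
Proof.
move=> x y; rewrite -[RHS]/(add (inj x) (opp (inj y))) oppE addE.
by apply/fracP; exists 0%N; rewrite /addf /= !exprD; ring.
Qed.

Fact inj_monoid_morphism : monoid_morphism inj.
Proof.
by split=> [//|x y]; rewrite -[RHS]/(mul (inj x) (inj y)) mulE.
Qed.

HB.instance Definition _ := GRing.isZmodMorphism.Build R type inj
  inj_zmod_morphism.
HB.instance Definition _ := GRing.isMonoidMorphism.Build R type inj
  inj_monoid_morphism.

Lemma is_localization_inj : is_localization inj f.
Proof.
have fracM x y : frac x * frac y = frac (mulf x y) := mulE x y.
split.
- exists (frac (1, 1%N)); rewrite fracM.
  by apply/fracP; exists 0%N; rewrite /= !exprD; ring.
- elim/fracW=> r n; exists r, n; rewrite -rmorphXn fracM.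
  by apply/fracP; exists 0%N; rewrite /= !exprD; ring.
- move=> r /fracP[k /= E]; exists k.
  by move: E; rewrite mulr0 addn0.
Qed.

End Localization.
End Localization.

(** A [property] takes a bundled morphism as argument, so pointwise equal composites must be
    identified as records. *)
Lemma rmorphism_eq (R S : pzRingType) (f g : {rmorphism R -> S}) :
  f =1 g -> f = g.
Proof.
move=> /funext.
case: f g => [f cf] [g cg] /= E; case: _ / E in cg *.
congr GRing.RMorphism.Pack.
case: cf cg => [[a] [b]] [[a'] [b']].
by rewrite (Prop_irrelevance a a') (Prop_irrelevance b b').
Qed.

(** Existence in the universal property, for any [S] meeting [is_localization]: send $s = r/f^n$ to
    $\psi(r) y^n$, where $y$ inverts $\psi(f)$. *)
Lemma localization_lift (R S T : comPzRingType) (phi : {rmorphism R -> S})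
    (f : R) (psi : {rmorphism R -> T}) :
  is_localization phi f -> (exists y, psi f * y = 1) ->
  exists chi : {rmorphism S -> T}, psi = (chi \o phi : {rmorphism R -> T}).
Proof.
move=> [_ numP kerP] [y fy].
have fyX n : psi f ^+ n * y ^+ n = 1 by rewrite -exprMn fy expr1n.
have cancel n u v : psi f ^+ n * u = psi f ^+ n * v -> u = v.
  by move=> /(congr1 ( *%R (y ^+ n))); rewrite !mulrA [_ ^+ n * _]mulrC fyX !mul1r.
have wd r : phi r = 0 -> psi r = 0.
  move=> /kerP[n E]; apply: (cancel n).
  by rewrite mulr0 -rmorphXn -rmorphM E rmorph0.
have /choice[h hP] s : exists h : R * nat, phi f ^+ h.2 * s = phi h.1.
  by have [r [n E]] := numP s; exists (r, n).
pose chi s : T := psi (h s).1 * y ^+ (h s).2.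
(* [chi] uses a chosen fraction; by [chiP] and [chiE] any other fraction for [s] gives the same
   value, so sums and products can be computed on convenient ones. *)
have chiP r n s : phi f ^+ n * s = phi r -> psi f ^+ n * chi s = psi r.
  move=> E; have : psi (f ^+ (h s).2 * r - f ^+ n * (h s).1) = 0.
    apply: wd; rewrite rmorphB !rmorphM -E -hP !rmorphXn.
    by rewrite mulrCA subrr.
  rewrite rmorphB !rmorphM => /subr0_eq; rewrite !rmorphXn => E'.
  by rewrite /chi mulrA -E' mulrAC fyX mul1r.
have chiE r n s : phi f ^+ n * s = phi r -> chi s = psi r * y ^+ n.
  by move=> /chiP E; apply: (cancel n); rewrite E mulrCA fyX mulr1.
have chiB : zmod_morphism chi.
  move=> s t; rewrite (chiE (f ^+ (h t).2 * (h s).1 - f ^+ (h s).2 * (h t).1)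
      ((h s).2 + (h t).2)%N); last first.
    by rewrite rmorphB !rmorphM -!hP !rmorphXn exprD; ring.
  rewrite rmorphB !rmorphM !rmorphXn /chi exprD.
  rewrite mulrBl; congr (_ - _).
    by rewrite [X in _ * X = _]mulrC mulrACA fyX mul1r.
  by rewrite [LHS]mulrACA fyX mul1r.
have chiM : monoid_morphism chi.
  split=> [|s t].
    by rewrite (chiE 1 0%N) ?rmorph1 ?mulr1.
  rewrite (chiE ((h s).1 * (h t).1) ((h s).2 + (h t).2)%N).
    by rewrite rmorphM /chi exprD mulrACA.
  by rewrite rmorphM -!hP exprD mulrACA.
pose chiZ := GRing.isZmodMorphism.Build S T chi chiB.
pose chiMM := GRing.isMonoidMorphism.Build S T chi chiM.
pose chiR : {rmorphism S -> T} := HB.pack chi chiZ chiMM.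
exists chiR; apply: rmorphism_eq => r /=.
by rewrite (chiE r 0%N) ?mulr1 // mul1r.
Qed.

Lemma localization_exists (R : comPzRingType) (f : R) :
  exists (S : comPzRingType) (phi : {rmorphism R -> S}), is_localization phi f.
Proof. by do 2!eexists; apply: Localization.is_localization_inj. Qed.

(** * Submodules and base change *)

Section SubmoduleTheory.
Variables (R : comPzRingType) (V : lmodType R).
Implicit Types B : set V.

Lemma submodule0 B : is_submodule B -> B 0. Proof. by case. Qed.

Lemma submoduleD B u v : is_submodule B -> B u -> B v -> B (u + v).
Proof. by move=> [_ BP] Bu Bv; rewrite -[u]scale1r; apply: BP. Qed.

Lemma submoduleZ B a u : is_submodule B -> B u -> B (a *: u).
Proof. by move=> [B0 BP] Bu; rewrite -[X in B X]addr0; apply: BP. Qed.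

Lemma submoduleN B u : is_submodule B -> B u -> B (- u).
Proof. by move=> sB Bu; rewrite -scaleN1r; apply: submoduleZ. Qed.

Lemma submoduleB B u v : is_submodule B -> B u -> B v -> B (u - v).
Proof. by move=> sB Bu Bv; apply: submoduleD => //; apply: submoduleN. Qed.

Lemma submodule_sum B (J : Type) (r : seq J) (P : pred J) (F : J -> V) :
  is_submodule B -> (forall j, P j -> B (F j)) -> B (\sum_(j <- r | P j) F j).
Proof.
move=> sB BF; elim/big_ind: _ => //; first exact: submodule0.
by move=> u v; apply: submoduleD.
Qed.

Lemma submoduleT : is_submodule [set: V]. Proof. by []. Qed.

Lemma submodule_set0 : is_submodule [set 0 : V].
Proof. by split=> // a u v /= -> ->; rewrite scaler0 addr0. Qed.

Lemma sub_span (X : set V) : X `<=` span X.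
Proof.
move=> x Xx; exists 1%N, (fun=> 1), (fun=> x); split=> //.
by rewrite big_ord1 scale1r.
Qed.

Lemma span_submodule (X : set V) : is_submodule (span X).
Proof.
split=> [|a u v [n [s [x [Xx ->]]]] [n' [s' [x' [Xx' ->]]]]].
  by exists 0%N, (fun=> 0), (fun=> 0); split=> [[]//|]; rewrite big_ord0.
exists (n + n')%N, (fun k => match fintype.split k with inl i => a * s i | inr i => s' i end),
  (fun k => match fintype.split k with inl i => x i | inr i => x' i end).
split=> [k|]; first by case: fintype.split.
rewrite big_split_ord scaler_sumr /=; congr (_ + _); apply: eq_bigr => i _.
  by rewrite (unsplitK (inl i)) scalerA.
by rewrite (unsplitK (inr i)).
Qed.

Lemma span_min (X B : set V) : is_submodule B -> X `<=` B -> span X `<=` B.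
Proof.
move=> sB XB v [n [s [x [Xx ->]]]]; apply: submodule_sum => // k _.
by apply: submoduleZ => //; apply: XB.
Qed.

End SubmoduleTheory.

Section BaseChangeTheory.
Variable I : finType.

Lemma map_vecP (R S : comPzRingType) (phi : {rmorphism R -> S}) (a : R)
    (u v : 'Mod[R]_I) :
  map_vec phi (a *: u + v) = phi a *: map_vec phi u + map_vec phi v.
Proof. by apply/ffunP => i; rewrite !ffunE rmorphD rmorphM. Qed.

Lemma map_vec0 (R S : comPzRingType) (phi : {rmorphism R -> S}) :
  map_vec phi (0 : 'Mod[R]_I) = 0.
Proof. by apply/ffunP => i; rewrite !ffunE rmorph0. Qed.

Lemma map_vecZ (R S : comPzRingType) (phi : {rmorphism R -> S}) (a : R)
    (u : 'Mod[R]_I) :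
  map_vec phi (a *: u) = phi a *: map_vec phi u.
Proof. by rewrite -[a *: u]addr0 map_vecP map_vec0 addr0. Qed.

Lemma map_vecB (R S : comPzRingType) (phi : {rmorphism R -> S})
    (u v : 'Mod[R]_I) :
  map_vec phi (u - v) = map_vec phi u - map_vec phi v.
Proof. by apply/ffunP => i; rewrite !ffunE rmorphB. Qed.

Lemma map_vec_sum (R S : comPzRingType) (phi : {rmorphism R -> S}) (J : Type)
    (r : seq J) (P : pred J) (a : J -> R) (x : J -> 'Mod[R]_I) :
  map_vec phi (\sum_(j <- r | P j) a j *: x j) =
  \sum_(j <- r | P j) phi (a j) *: map_vec phi (x j).
Proof.
by elim/big_rec2: _ => [|j u v _ <-]; rewrite ?map_vec0 // map_vecP.
Qed.

Section OneMap.
Variables (R S : comPzRingType) (phi : {rmorphism R -> S}).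
Implicit Types B : set 'Mod[R]_I.

Lemma base_change_submodule B : is_submodule (base_change phi B).
Proof. exact: span_submodule. Qed.

Lemma base_change_map B v : B v -> base_change phi B (map_vec phi v).
Proof. by move=> Bv; apply: sub_span; exists v. Qed.

(** The induction principle for base changes: a condition that cuts out a submodule need only be
    checked on images of vectors of [B]. *)
Lemma base_change_min B (C : set 'Mod[S]_I) : is_submodule C ->
  (forall v, B v -> C (map_vec phi v)) -> base_change phi B `<=` C.
Proof. by move=> sC BC; apply: span_min => // _ [v /BC Cv <-]. Qed.

Lemma base_changeS B B' : B `<=` B' -> base_change phi B `<=` base_change phi B'.
Proof.
move=> BB'; apply: base_change_min => [|v /BB']; first exact: base_change_submodule.
exact: base_change_map.
Qed.

Lemma base_change_set0 : base_change phi [set 0] = [set 0 : 'Mod[S]_I].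
Proof.
apply/seteqP; split=> [|_ /= ->]; last first.
  by apply: submodule0; apply: base_change_submodule.
by apply: base_change_min => [|v /= ->]; [exact: submodule_set0|exact: map_vec0].
Qed.

End OneMap.

Lemma base_change_comp (R S T : comPzRingType) (phi : {rmorphism R -> S})
    (chi : {rmorphism S -> T}) (B : set 'Mod[R]_I) :
  base_change (chi \o phi) B = base_change chi (base_change phi B).
Proof.
have E v : map_vec (chi \o phi) v = map_vec chi (map_vec phi v) :> 'Mod[T]_I.
  by apply/ffunP => i; rewrite !ffunE.
apply/seteqP; split.
  apply: base_change_min => [|v Bv]; first exact: base_change_submodule.
  by rewrite E; do 2!apply: base_change_map.
apply: base_change_min => [|v]; first exact: base_change_submodule.
move=> [n [a [x [Xx ->]]]]; rewrite map_vec_sum.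
apply: submodule_sum => [|k _]; first exact: base_change_submodule.
apply: submoduleZ; first exact: base_change_submodule.
by have [w Bw <-] := Xx k; rewrite -E; apply: base_change_map.
Qed.

Lemma base_change_localization (R S : comPzRingType) (phi : {rmorphism R -> S})
    (f : R) (B : set 'Mod[R]_I) (v : 'Mod[S]_I) :
  is_localization phi f -> is_submodule B -> base_change phi B v ->
  exists n w, B w /\ phi f ^+ n *: v = map_vec phi w.
Proof.
move=> [_ numP _] sB; move: v.
pose C := [set v : 'Mod[S]_I | exists n w, B w /\ phi f ^+ n *: v = map_vec phi w].
apply: (@base_change_min _ _ _ _ C) => [|v Bv]; last first.
  by exists 0%N, v; rewrite scale1r.
split=> [|s u v [n [w [Bw Ew]]] [n' [w' [Bw' Ew']]]].
  by exists 0%N, 0; split; [exact: submodule0|rewrite scaler0 map_vec0].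
have [r [k E]] := numP s.
exists (k + n + n')%N, (f ^+ n' *: (r *: w) + f ^+ (k + n) *: w'); split.
  by apply: submoduleD => //; do ?apply: submoduleZ.
rewrite map_vecP !map_vecZ -Ew -Ew' -E !rmorphXn scalerDr !scalerA.
by congr (_ *: _ + _ *: _); rewrite !exprD; ring.
Qed.

End BaseChangeTheory.

Arguments base_changeS {I R S} phi [B B'].

(** * Covers of Spec R by basic opens where a property holds *)

Section Covered.

Definition property (R : comPzRingType) :=
  forall S : comPzRingType, {rmorphism R -> S} -> Prop.

Definition stable (R : comPzRingType) (Q : property R) : Prop :=
  forall (S T : comPzRingType) (phi : {rmorphism R -> S}) (chi : {rmorphism S -> T}),
    Q S phi -> Q T (chi \o phi).

Definition pull (R S : comPzRingType) (phi : {rmorphism R -> S})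
  (Q : property R) : property S := fun T chi => Q T (chi \o phi).

(** Quantifying over all algebras that invert $f$, rather than over one localization, makes this set
    stable under multiplication by elements of [R] and compatible with pullback. *)
Definition good (R : comPzRingType) (Q : property R) : set R^o :=
  [set f | forall (S : comPzRingType) (phi : {rmorphism R -> S}),
    (exists y, phi f * y = 1) -> Q S phi].

(* Spec R is covered by basic opens D(f) such that Q holds over every affine  *)
(* scheme over D(f).                                                          *)
Definition covered (R : comPzRingType) (Q : property R) : Prop :=
  span (good Q) 1.

Definition span_good_submodule (R : comPzRingType) (Q : property R) :
  is_submodule (span (good Q)) := @span_submodule R R^o (good Q).

Lemma ideal_mull (R : comPzRingType) (J : set R) a x :
  is_ideal J -> J x -> J (a * x).
Proof. exact: (@submoduleZ R R^o J a x). Qed.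

Lemma partition_of_powers (R : comPzRingType) (J : set R) n (f a : 'I_n -> R) :
  is_ideal J -> \sum_k a k * f k = 1 ->
  (forall k, exists m, J (f k ^+ m)) -> J 1.
Proof.
move=> iJ af1 /choice[m Jm].
suff H (r : seq 'I_n) : exists M, J ((\sum_(k <- r) a k * f k) ^+ M).
  by have [M] := H (index_enum 'I_n); rewrite af1 expr1n.
elim: r => [|k r [M JM]].
  by exists 1%N; rewrite big_nil expr1; exact: (@submodule0 R R^o).
(* In each binomial term either $a_k f_k$ has exponent at least [m k], or the remaining sum has
   exponent at least [M]. *)
exists (m k + M)%N; rewrite big_cons exprDn.
apply: (@submodule_sum R R^o) => // i _; rewrite -mulr_natl.
apply: ideal_mull => //.
have [le_iM|lt_Mi] := leqP i M.
  rewrite mulrC -addnBA // exprD [X in J (_ * X)]mulrC; apply: ideal_mull => //.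
  by apply: ideal_mull => //; rewrite exprMn; apply: ideal_mull.
rewrite -(subnK (ltnW lt_Mi)) exprD mulrA.
by do 2!apply: ideal_mull => //.
Qed.

End Covered.

(** * Properties that hold locally on Spec R *)

Section CoveredTheory.
Variable R : comPzRingType.
Implicit Types Q : property R.

(** The shape of [locally_free_quotient_in], with an arbitrary property in place of freeness. *)
Definition locally Q : Prop :=
  exists (n : nat) (f : 'I_n -> R),
    (exists a : 'I_n -> R, \sum_k a k * f k = 1) /\
    forall k, exists (S : comPzRingType) (phi : {rmorphism R -> S}),
      is_localization phi (f k) /\ Q S phi.

Lemma covered_locally Q : covered Q -> locally Q.
Proof.
move=> [n [a [f [gf E]]]]; exists n, f; split=> [|k]; first by exists a.
have [S [phi loc]] := localization_exists (f k : R); exists S, phi; split=> //.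
by have [u _ _] := loc; apply: (gf k _ phi u).
Qed.

(** Every morphism inverting $f_k$ factors through the given localization, and stability transports
    [Q] along the second factor. *)
Lemma locally_covered Q : stable Q -> locally Q -> covered Q.
Proof.
move=> sQ [n [f [[a E] gf]]]; exists n, a, f; split=> // k T psi u.
have [S [phi [loc QS]]] := gf k.
have [chi ->] := localization_lift loc u; exact: sQ.
Qed.

Lemma covered_mono Q Q' : (forall S phi, Q S phi -> Q' S phi) ->
  covered Q -> covered Q'.
Proof.
move=> QQ'; apply: span_min => [|f gf]; first exact: span_submodule.
by apply: sub_span => S phi u; apply/QQ'/gf.
Qed.

Lemma covered_zero Q : (1 : R) = 0 -> covered Q.
Proof. by rewrite /covered => ->; exact: submodule0 (span_good_submodule Q). Qed.

Lemma covered_everywhere Q : (forall S phi, Q S phi) -> covered Q.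
Proof. by move=> QT; apply: sub_span => S phi _; apply: QT. Qed.

Lemma good_mul Q f a : good Q f -> good Q (a * f).
Proof.
move=> gf S phi [y E]; apply: gf; exists (phi a * y).
by rewrite mulrCA mulrA -rmorphM.
Qed.

(** Products $gf$ refine two covers, since $D(gf) = D(g) \cap D(f)$; the ideal argument treats one
    factor at a time. *)
Lemma covered_and Q Q' : covered Q -> covered Q' ->
  covered (fun S phi => Q S phi /\ Q' S phi).
Proof.
move=> cQ cQ'; rewrite /covered; set J := span _.
have iJ : is_ideal J by apply: span_submodule.
suff H x : span (good Q) x -> J x by apply: H.
apply: span_min => // f gf.
suff H y : span (good Q') y -> J (y * f) by rewrite -[f]mul1r; apply: H.
pose K : set R^o := [set y | J (y * f)].
apply: (@span_min R R^o (good Q') K) => [|g gg].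
  split=> [|b u v Ku Kv]; rewrite /K /=.
    by rewrite mul0r; exact: (@submodule0 R R^o).
  by rewrite /GRing.scale /= mulrDl -mulrA; case: iJ => _; apply.
apply: sub_span => S phi u; split.
  exact: (@good_mul Q f g gf S phi u).
by apply: (@good_mul Q' g f gg S phi); rewrite mulrC.
Qed.

Lemma covered_pull Q (S : comPzRingType) (phi : {rmorphism R -> S}) :
  covered Q -> covered (pull phi Q).
Proof.
move=> [n [a [f [gf E]]]]; exists n, (phi \o a), (phi \o f); split=> [k T chi u|].
  exact: (gf k T (chi \o phi) u).
by rewrite -(rmorph1 phi) E rmorph_sum; apply: eq_bigr => k _; exact: rmorphM.
Qed.

End CoveredTheory.

Lemma pull_comp (R S T : comPzRingType) (phi : {rmorphism R -> S})
    (chi : {rmorphism S -> T}) (Q : property R) :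
  pull chi (pull phi Q) = pull (chi \o phi) Q.
Proof.
apply: functional_extensionality_dep => U; apply/funext => psi.
by rewrite /pull; congr Q; apply: rmorphism_eq.
Qed.

Lemma stable_covered (R : comPzRingType) (Q : property R) :
  stable (fun S phi => covered (pull phi Q)).
Proof. by move=> S T phi chi /covered_pull -/(_ _ chi); rewrite pull_comp. Qed.

(** On $D(f_k)$ the unit is a combination of good elements; clearing denominators puts a power of
    $f_k$ into the ideal spanned by [good Q], and [partition_of_powers] concludes. *)
Lemma covered_trans (R : comPzRingType) (Q : property R) :
  covered (fun S phi => covered (pull phi Q)) -> covered Q.
Proof.
move=> [n [a [f [gf E]]]].
have iJ : is_ideal (span (good Q)) := span_good_submodule Q.
apply: (partition_of_powers iJ (esym E)) => k.
have [S [phi loc]] := localization_exists (f k : R).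
have [[y fy] numP kerP] := loc.
pose C : set S^o := [set s | exists n r, span (good Q) r /\ phi (f k) ^+ n * s = phi r].
have [m [r [Jr Er]]] : C 1.
  have : covered (pull phi Q) by apply: (gf k S phi); exists y.
  apply: (@span_min S S^o (good (pull phi Q)) C) => [|h gh].
    split=> [|s u v [m [r [Jr Er]]] [m' [r' [Jr' Er']]]].
      by exists 0%N, 0; rewrite mulr0 rmorph0; split=> //; exact: (@submodule0 R R^o).
    have [t [p Et]] := numP s.
    exists (m + m' + p)%N, (f k ^+ m' * (t * r) + f k ^+ (p + m) * r'); split.
      by apply: (@submoduleD R R^o) => //; do ?apply: ideal_mull.
    rewrite rmorphD !rmorphM -Et -Er -Er' !rmorphXn /GRing.scale /= !exprD.
    by ring.
  (* The extra factor $f_k$ ensures that a morphism inverting $f_k r$ also inverts $f_k$. It then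
     factors through [S], where $h$ equals $r$ up to a power of the unit $f_k$ and so becomes
     invertible too. *)
  have [r [m Er]] := numP h; exists m.+1, (f k * r); split.
    apply: sub_span => T psi [z Ez].
    have [chi Echi] : exists chi : {rmorphism S -> T}, psi = (chi \o phi : {rmorphism R -> T}).
      by apply: (localization_lift loc); exists (psi r * z); rewrite mulrA -rmorphM.
    rewrite Echi; apply: gh.
    exists (psi (f k) * (z * psi (f k) ^+ m)); rewrite -[RHS]Ez rmorphM.
    have -> : psi r = psi (f k) ^+ m * chi h.
      by rewrite Echi /= -rmorphXn -rmorphM Er.
    by ring.
  by rewrite exprS -mulrA Er rmorphM.
have /kerP[p Ep] : phi (f k ^+ m - r) = 0.
  by rewrite rmorphB rmorphXn -Er mulr1 subrr.
exists (p + m)%N; rewrite exprD.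
move: Ep; rewrite mulrBr => /subr0_eq ->; exact: ideal_mull.
Qed.

Lemma locally_covered_trans (R : comPzRingType) (Q : property R) :
  locally (fun S phi => covered (pull phi Q)) -> covered Q.
Proof. by move=> lQ; apply/covered_trans/locally_covered/lQ/stable_covered. Qed.

(** * Bases of quotient modules *)

(** The zero ring is a genuine exception: there all free modules are isomorphic. *)
Lemma invariant_basis_number (R : comPzRingType) m n
    (A : 'M[R]_(m, n)) (B : 'M[R]_(n, m)) :
  A *m B = 1%:M -> (m <= n)%N \/ (1 : R) = 0.
Proof.
move=> AB; have [R0|/eqP R1] := eqVneq (1 : R) 0; [by right|left].
pose nz := GRing.PzSemiRing_isNonZero.Build R (introN eqP R1).
pose R' : comNzRingType := HB.pack R nz.
exact: (@mulmx1_min R' m n A B AB).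
Qed.

Section QuotientBasis.
Variables (R : comPzRingType) (V : lmodType R).
Implicit Types (M B : set V).

Definition comb q (x : 'rV[R]_q) (e : 'I_q -> V) : V := \sum_k x 0 k *: e k.

Lemma combD q (x y : 'rV[R]_q) e : comb (x + y) e = comb x e + comb y e.
Proof.
by rewrite -big_split; apply: eq_bigr => k _; rewrite mxE scalerDl.
Qed.

Lemma combZ q a (x : 'rV[R]_q) e : comb (a *: x) e = a *: comb x e.
Proof. by rewrite scaler_sumr; apply: eq_bigr => k _; rewrite mxE scalerA. Qed.

Lemma comb0 q (e : 'I_q -> V) : comb 0 e = 0.
Proof. by apply: big1 => k _; rewrite mxE scale0r. Qed.

Lemma combB q (x y : 'rV[R]_q) e : comb (x - y) e = comb x e - comb y e.
Proof.
by rewrite -sumrB; apply: eq_bigr => k _; rewrite !mxE scalerBl.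
Qed.

Lemma comb_delta q k (e : 'I_q -> V) : comb (delta_mx 0 k) e = e k.
Proof.
rewrite /comb (bigD1 k) //= mxE !eqxx scale1r big1 ?addr0 // => l nlk.
by rewrite mxE (negPf nlk) andbF scale0r.
Qed.

Lemma comb_row_mx p q (x : 'rV[R]_p) (y : 'rV[R]_q) (e : 'I_(p + q) -> V) :
  comb (row_mx x y) e =
    comb x (fun k => e (lshift q k)) + comb y (fun k => e (rshift p k)).
Proof.
rewrite /comb big_split_ord.
by congr (_ + _); apply: eq_bigr => k _; rewrite ?row_mxEl ?row_mxEr.
Qed.

Lemma comb_mulmx p q (x : 'rV[R]_p) (A : 'M[R]_(p, q)) (e : 'I_q -> V) :
  comb (x *m A) e = comb x (fun k => comb (row k A) e).
Proof.
rewrite /comb; under [RHS]eq_bigr do rewrite scaler_sumr.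
rewrite exchange_big; apply: eq_bigr => k _; rewrite mxE scaler_suml.
by apply: eq_bigr => l _; rewrite mxE scalerA.
Qed.

Lemma submodule_comb B q (x : 'rV[R]_q) (e : 'I_q -> V) :
  is_submodule B -> (forall k, B (e k)) -> B (comb x e).
Proof.
by move=> sB Be; apply: submodule_sum => // k _; apply: submoduleZ.
Qed.

Lemma submodule_comb_sub B q (x : 'rV[R]_q) (e e' : 'I_q -> V) :
  is_submodule B -> (forall k, B (e k - e' k)) -> B (comb x e - comb x e').
Proof.
move=> sB Be; suff -> : comb x e - comb x e' = comb x (fun k => e k - e' k).
  exact: submodule_comb.
by rewrite /comb -sumrB; apply: eq_bigr => k _; rewrite scalerBr.
Qed.

Definition quotient_basis M B q (e : 'I_q -> V) : Prop :=
  [/\ forall k, M (e k), forall v, M v -> exists x : 'rV_q, B (v - comb x e) &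
      forall x : 'rV_q, B (comb x e) -> x = 0].

Lemma free_quotientP M B q : is_submodule M -> is_submodule B ->
  free_quotient M B q <-> exists e : 'I_q -> V, quotient_basis M B e.
Proof.
move=> sM sB.
have combE (x : {ffun 'I_q -> R}) (e : 'I_q -> V) :
    \sum_k x k *: e k = comb (\row_k x k) e.
  by apply: eq_bigr => k _; rewrite mxE.
split=> -[e].
  move=> [Me eP]; exists e; split=> // [v /eP[x [Bx _]]|x Bx].
    by exists (\row_k x k); rewrite -combE.
  (* Uniqueness is used at the vector $0$, which has both $-x$ and $0$ as coordinates. *)
  have [y [_ yU]] := eP 0 (submodule0 sM).
  have xy : y = [ffun k => - x 0 k].
    apply: yU; rewrite combE sub0r -scaleN1r -combZ; congr B: Bx.
    by congr comb; apply/rowP => k; rewrite !mxE ffunE mulN1r opprK.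
  have y0 : y = 0.
    by apply: yU; rewrite big1 ?subr0 => [|k _]; rewrite ?ffunE ?scale0r //; apply: submodule0.
  apply/rowP => k; rewrite mxE -[x 0 k]opprK.
  by move/ffunP: xy => /(_ k); rewrite y0 !ffunE => <-; rewrite oppr0.
move=> [Me eS eI]; exists e; split=> // v /eS[x Bx].
exists [ffun k => x 0 k]; split=> [|y By].
  by rewrite combE; congr B: Bx; congr (_ - comb _ _); apply/rowP => k; rewrite mxE ffunE.
apply/ffunP => k; rewrite ffunE; apply/subr0_eq.
have /rowP/(_ k) : x - \row_k y k = 0; last by rewrite !mxE.
apply: eI; rewrite combB -combE.
rewrite (_ : _ - _ = (v - \sum_k y k *: e k) - (v - comb x e)); last first.
  by rewrite opprB [RHS]addrC subrKA.
exact: submoduleB.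
Qed.

Lemma quotient_basis_mx M B q (e : 'I_q -> V) p (w : 'I_p -> V) :
  quotient_basis M B e -> (forall k, M (w k)) ->
  exists A : 'M[R]_(p, q), forall k, B (w k - comb (row k A) e).
Proof.
move=> [_ eS _] Mw; have /choice[a aP] k := eS _ (Mw k).
by exists (\matrix_k a k) => k; rewrite rowK.
Qed.

Lemma quotient_basis_inj M B q (e : 'I_q -> V) (x y : 'rV_q) : is_submodule B ->
  quotient_basis M B e -> B (comb x e - comb y e) -> x = y.
Proof. by move=> sB [_ _ eI] Bxy; apply/subr0_eq/eI; rewrite combB. Qed.

Lemma quotient_basis_cat M' M B p q (e : 'I_p -> V) (u : 'I_q -> V) :
  is_submodule M -> is_submodule B -> B `<=` M -> M `<=` M' ->
  quotient_basis M B e -> quotient_basis M' M u ->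
  quotient_basis M' B
    (fun k => match fintype.split k with inl i => e i | inr j => u j end).
Proof.
move=> sM sB BM MM' [Me eS eI] [Mu uS uI]; set w := fun k => _.
have wE (x : 'rV_p) (y : 'rV_q) : comb (row_mx x y) w = comb x e + comb y u.
  rewrite comb_row_mx; congr (_ + _); apply: eq_bigr => k _; rewrite /w.
    by rewrite (unsplitK (inl k)).
  by rewrite (unsplitK (inr k)).
split=> [k|v /uS[y My]|z].
- by rewrite /w; case: fintype.split => // i; apply: MM'.
- have [x Bx] := eS _ My; exists (row_mx x y).
  by rewrite wE opprD addrA addrAC.
- rewrite -[z]hsubmxK wE => Bz.
  have y0 : rsubmx z = 0.
    apply: uI; rewrite -[comb _ _](addKr (comb (lsubmx z) e)) addrC.
    apply: submoduleB => //; first exact: BM.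
    exact: submodule_comb.
  by move: Bz; rewrite y0 comb0 addr0 => /eI ->; rewrite row_mx0.
Qed.

Lemma quotient_basis_rank M B p q (e : 'I_p -> V) (w : 'I_q -> V) :
  is_submodule B -> quotient_basis M B e -> quotient_basis M B w ->
  p = q \/ (1 : R) = 0.
Proof.
move=> sB.
suff H p' q' (e' : 'I_p' -> V) (w' : 'I_q' -> V) :
    quotient_basis M B e' -> quotient_basis M B w' -> (p' <= q')%N \/ (1 : R) = 0.
  move=> be bw; have [le_pq|] := H _ _ _ _ be bw; last by right.
  have [le_qp|] := H _ _ _ _ bw be; last by right.
  by left; apply/eqP; rewrite eqn_leq le_pq.
move=> be bw; have [A AP] := quotient_basis_mx bw (let: And3 Me _ _ := be in Me).
have [C CP] := quotient_basis_mx be (let: And3 Mw _ _ := bw in Mw).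
apply: (invariant_basis_number (A := A) (B := C)); apply/row_matrixP => k.
rewrite row_mul row1; apply: (quotient_basis_inj sB be).
rewrite comb_delta comb_mulmx.
rewrite -[X in B X](subrKA (comb (row k A) w')).
apply: submoduleD => //; last first.
  by rewrite -opprB; apply: submoduleN.
by rewrite -opprB; apply: submoduleN => //; apply: submodule_comb_sub => // l; apply: CP.
Qed.

(* e is a basis of M' / B, u one of M' / M, and P the matrix of the           *)
(* projection M' / B -> M' / M, whose kernel M / B has basis E' e.            *)
Lemma quotient_basis_ker M M' B q d r (e : 'I_q -> V) (u : 'I_d -> V)
    (P : 'M[R]_(q, d)) (E : 'M[R]_(d, q)) (E' : 'M[R]_(r, q)) (P' : 'M[R]_(q, r)) :
  is_submodule M -> is_submodule B -> B `<=` M -> M `<=` M' ->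
  quotient_basis M' B e -> quotient_basis M' M u ->
  (forall k, M (e k - comb (row k P) u)) ->
  E' *m P = 0 -> E' *m P' = 1%:M -> P *m E + P' *m E' = 1%:M ->
  quotient_basis M B (fun a => comb (row a E') e).
Proof.
move=> sM sB BM MM' be bu PP E'P E'P' PE.
have [Me eS eI] := be; have [Mu uS uI] := bu.
have proj (x : 'rV_q) : M (comb x e - comb (x *m P) u).
  by rewrite comb_mulmx; apply: submodule_comb_sub.
split=> [a|v Mv|y].
- have := proj (row a E'); rewrite -row_mul E'P.
  by rewrite (_ : row a 0 = 0) ?comb0 ?subr0 //; apply/rowP => k; rewrite !mxE.
- have [x Bx] := eS _ (MM' _ Mv); exists (x *m P').
  rewrite -comb_mulmx -mulmxA.
  have Mx : M (comb x e).
    by rewrite -[comb x e](subKr v); apply: submoduleB => //; apply: BM.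
  have xP : x *m P = 0.
    by apply: uI; rewrite -[comb _ u](subKr (comb x e)); apply: submoduleB.
  suff -> : x *m (P' *m E') = x by [].
  by rewrite -[RHS]mulmx1 -PE mulmxDr [x *m (P *m E)]mulmxA xP mul0mx add0r.
- rewrite -comb_mulmx => /eI yE'.
  by rewrite -[y]mulmx1 -E'P' mulmxA yE' mul0mx.
Qed.

End QuotientBasis.

(** * Maximal minors and coordinate submodules *)

(** Cauchy-Binet before grouping: multilinearity in the rows gives a sum over all row selections,
    repetitions included. *)
Lemma det_mulmx_rowsub (R : comPzRingType) d q
    (E : 'M[R]_(d, q)) (P : 'M[R]_(q, d)) :
  \det (E *m P) =
    \sum_(f : {ffun 'I_d -> 'I_q}) (\prod_i E i (f i)) * \det (rowsub f P).
Proof.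
rewrite /determinant; under [RHS]eq_bigr do rewrite mulr_sumr.
rewrite exchange_big; apply: eq_bigr => s _ /=.
rewrite (_ : \prod_i (E *m P) i (s i) = \prod_i \sum_j E i j * P j (s i)).
  rewrite bigA_distr_bigA mulr_sumr; apply: eq_bigr => f _.
  rewrite mulrCA -big_split /=; congr (_ * _).
  by apply: eq_bigr => i _; rewrite mxE.
by apply: eq_bigr => i _; rewrite mxE.
Qed.

(** Let $S_f$, $S_g$ select the coordinates in the image of $f$ and the others, and let $D = S_f P$
    be the invertible minor. A row $x$ with $xP = 0$ is determined by its $g$-coordinates, those
    along $f$ being $-x_g S_g P D^{-1}$. *)
Lemma completion_of_unit_minor (R : comPzRingType) d q (P : 'M[R]_(q, d))
    (f : 'I_d -> 'I_q) y : injective f -> \det (rowsub f P) * y = 1 ->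
  exists r, (r + d)%N = q /\
  exists (E : 'M[R]_(d, q)) (E' : 'M[R]_(r, q)) (P' : 'M[R]_(q, r)),
    [/\ E' *m P = 0, E' *m P' = 1%:M & P *m E + P' *m E' = 1%:M].
Proof.
move=> f_inj Dy; pose A := [pred j | j \notin codom f].
have cardA : (#|A| + d)%N = q.
  rewrite addnC -[in RHS](card_ord q) -(cardC (mem (codom f))).
  by rewrite (card_codom f_inj) card_ord.
exists #|A|; split=> //.
pose g (a : 'I_#|A|) : 'I_q := enum_val a.
have g_inj : injective g := enum_val_inj.
have fg a i : (g a == f i) = false.
  by apply/eqP => gf; have := enum_valP a; rewrite inE -/(g a) gf codom_f.
pose Sf : 'M[R]_(d, q) := rowsub f 1%:M; pose Sg : 'M[R]_(#|A|, q) := rowsub g 1%:M.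
have SfP : rowsub f P = Sf *m P by exact: rowsubE.
pose D' := y *: \adj (rowsub f P).
have DD' : Sf *m P *m D' = 1%:M.
  by rewrite -SfP /D' -scalemxAr mul_mx_adj scale_scalar_mx mulrC Dy.
have D'D : D' *m (Sf *m P) = 1%:M.
  by rewrite -SfP /D' -scalemxAl mul_adj_mx scale_scalar_mx mulrC Dy.
have SgSg : Sg *m Sg^T = 1%:M.
  apply/matrixP => a b; rewrite !mxE (bigD1 (g a)) //= !mxE eqxx mul1r.
  rewrite big1 ?addr0 => [|j /negPf nj].
    by rewrite (inj_eq g_inj) eq_sym.
  by rewrite !mxE eq_sym nj mul0r.
have SfSg : Sf *m Sg^T = 0.
  apply/matrixP => i a; rewrite !mxE big1 // => j _; rewrite !mxE.
  by case: eqP => [<-|_]; rewrite ?mul0r // mul1r fg.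
have SS : Sf^T *m Sf + Sg^T *m Sg = 1%:M.
  apply/matrixP => i j; rewrite !mxE.
  have [/codomP[k ->]|nf] := boolP (i \in codom f).
    rewrite [X in _ + X]big1 ?addr0 => [|a _]; last by rewrite !mxE fg mul0r.
    rewrite (bigD1 k) //= !mxE eqxx mul1r big1 ?addr0 // => l /negPf nl.
    by rewrite !mxE (inj_eq f_inj) nl mul0r.
  have Ai : i \in A by [].
  rewrite big1 ?add0r => [|k _]; last first.
    rewrite !mxE; case: eqP => [fi|_]; last by rewrite mul0r.
    by rewrite -fi codom_f in nf.
  rewrite (bigD1 (enum_rank_in Ai i)) //= !mxE /g enum_rankK_in // eqxx mul1r.
  rewrite big1 ?addr0 // => b nb; rewrite !mxE.
  case: eqP => [gi|_]; last by rewrite mul0r.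
  by case/eqP: nb; rewrite -[LHS](enum_valK_in Ai); congr enum_rank_in.
(* In order: a left inverse of [P], the kernel as a graph over the complementary coordinates, and
   the map reading off those coordinates. *)
exists (D' *m Sf), (Sg - Sg *m P *m D' *m Sf), Sg^T; split.
- by rewrite mulmxBl -!mulmxA D'D mulmx1 subrr.
- by rewrite mulmxBl SgSg -[_ *m Sf *m _]mulmxA SfSg mulmx0 subr0.
- have -> : Sg^T *m (Sg - Sg *m P *m D' *m Sf)
      = Sg^T *m Sg *m (1%:M - P *m D' *m Sf).
    by rewrite mulmxBr mulmxBr mulmx1 !mulmxA.
  have -> : Sg^T *m Sg = 1%:M - Sf^T *m Sf by rewrite -SS addrC addKr.
  have XT : Sf^T *m Sf *m (P *m D' *m Sf) = Sf^T *m Sf.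
    by rewrite -!mulmxA (mulmxA P) (mulmxA Sf) (mulmxA Sf) DD' mul1mx.
  by rewrite mulmxA mulmxBl mul1mx mulmxBr mulmx1 XT subrr subr0 addrC subrK.
Qed.

(* Since E P = 1, the maximal minors of P generate the unit ideal.            *)
Lemma covered_completion (R : comPzRingType) d q
    (E : 'M[R]_(d, q)) (P : 'M[R]_(q, d)) : E *m P = 1%:M ->
  covered (fun (S : comPzRingType) (phi : {rmorphism R -> S}) =>
    exists r, (r + d)%N = q /\
    exists (E0 : 'M[S]_(d, q)) (E' : 'M[S]_(r, q)) (P' : 'M[S]_(q, r)),
      [/\ E' *m map_mx phi P = 0, E' *m P' = 1%:M &
          map_mx phi P *m E0 + P' *m E' = 1%:M]).
Proof.
move=> /(congr1 determinant); rewrite det1 det_mulmx_rowsub /covered => <-.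
apply: (@submodule_sum R R^o) => [|f _]; first exact: span_good_submodule.
apply: ideal_mull; first exact: span_good_submodule.
(* A selection that is not injective repeats a row, so its minor vanishes. *)
have [/injectiveP f_inj|/injectivePn[i [j nij fij]]] := boolP (injectiveb f).
  apply: sub_span => S phi [y Ey].
  apply: (completion_of_unit_minor f_inj (y := y)).
  by rewrite -Ey -det_map_mx; congr (\det _ * _); apply/matrixP => a b; rewrite !mxE.
rewrite (determinant_alternate nij) => [|k]; last by rewrite !mxE fij.
exact: (submodule0 (span_good_submodule _)).
Qed.

(** * Coordinate submodules and their base change *)

Section CoordinateSubmodule.
Variable I : finType.

(** Covers at once the whole module ([predT]) and $R \otimes A^{spine}$ ([in_spine]); such a
    submodule has a basis defined over every ring. *)
Definition coord_submodule (J : {pred I}) (R : comPzRingType) : set 'Mod[R]_I :=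
  [set v | forall i, i \notin J -> v i = 0].

Definition basis_vec (R : comPzRingType) (i : I) : 'Mod[R]_I :=
  [ffun j => (j == i)%:R].

Arguments coord_submodule : clear implicits.
Arguments basis_vec : clear implicits.

Lemma vec_expand (R : comPzRingType) (v : 'Mod[R]_I) :
  v = \sum_i v i *: basis_vec R i.
Proof.
apply/ffunP => j; rewrite sum_ffunE (bigD1 j) //= !ffunE eqxx.
rewrite big1 => [|i /negPf nij]; last by rewrite !ffunE eq_sym nij; apply: mulr0.
by rewrite addr0; apply/esym/mulr1.
Qed.

Variable J : {pred I}.
Local Notation C := (coord_submodule J).

Lemma coord_submodule_expand (R : comPzRingType) (v : 'Mod[R]_I) : C R v ->
  v = \sum_(i in J) v i *: basis_vec R i.
Proof.
move=> Cv; rewrite {1}[v]vec_expand (bigID (mem J)) /= [X in _ + X]big1 ?addr0 //.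
by move=> i /Cv ->; rewrite scale0r.
Qed.

Lemma coord_submoduleP (R : comPzRingType) : is_submodule (C R).
Proof.
split=> [i _|a u v Cu Cv i Ji]; rewrite !ffunE //.
by rewrite Cu // Cv // scaler0 addr0.
Qed.

Lemma coord_submodule_basis (R : comPzRingType) i : i \in J -> C R (basis_vec R i).
Proof. by move=> Ji j Jj; rewrite ffunE; case: eqP Jj => // ->; rewrite Ji. Qed.

Lemma map_basis_vec (R S : comPzRingType) (phi : {rmorphism R -> S}) i :
  map_vec phi (basis_vec R i) = basis_vec S i.
Proof. by apply/ffunP => j; rewrite !ffunE rmorph_nat. Qed.

Lemma coord_submodule_map (R S : comPzRingType) (phi : {rmorphism R -> S}) v :
  C R v -> C S (map_vec phi v).
Proof. by move=> Cv i Ji; rewrite ffunE Cv // rmorph0. Qed.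

Lemma base_change_coord (R S : comPzRingType) (phi : {rmorphism R -> S}) :
  base_change phi (C R) = C S.
Proof.
apply/seteqP; split=> [|v Cv].
  apply: base_change_min; [exact: coord_submoduleP|exact: coord_submodule_map].
rewrite (coord_submodule_expand Cv); apply: submodule_sum => [|i Ji].
  exact: base_change_submodule.
apply: submoduleZ; first exact: base_change_submodule.
by rewrite -(map_basis_vec phi); apply/base_change_map/coord_submodule_basis.
Qed.

(** The coordinate map [P], with kernel [B], is given by a matrix on the basis vectors. The image
    [P'] of this matrix over [S] kills the base change of [B] and inverts [comb], which gives
    independence. *)
Lemma quotient_basis_base_change (R S : comPzRingType) (phi : {rmorphism R -> S})
    (B : set 'Mod[R]_I) q (e : 'I_q -> 'Mod[R]_I) :
  is_submodule B -> B `<=` C R -> quotient_basis (C R) B e ->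
  quotient_basis (C S) (base_change phi B) (map_vec phi \o e).
Proof.
move=> sB BC be; have [Ce eS _] := be.
have /choice[p pP] i : exists x : 'rV[R]_q, i \in J -> B (basis_vec R i - comb x e).
  have [Ji|] := boolP (i \in J); last by exists 0.
  by have [x Bx] := eS _ (coord_submodule_basis R Ji); exists x.
pose P v := \sum_(i in J) v i *: p i.
have P_mod v : C R v -> B (v - comb (P v) e).
  move=> Cv; have -> : v - comb (P v) e
      = \sum_(i in J) v i *: (basis_vec R i - comb (p i) e).
    under eq_bigr do rewrite scalerBr -combZ.
    rewrite sumrB -coord_submodule_expand //; congr (_ - _).
    by rewrite /P; elim/big_rec2: _ => [|i w x _ <-]; rewrite ?comb0 ?combD.
  by apply: submodule_sum => // i Ji; apply: submoduleZ => //; apply: pP.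
have P_B v : B v -> P v = 0.
  move=> Bv; apply: (quotient_basis_inj sB be).
  rewrite comb0 subr0 -[comb _ _](subKr v); apply: submoduleB => //.
  exact/P_mod/BC.
have P_e k : P (e k) = delta_mx 0 k.
  apply/esym/(quotient_basis_inj sB be); rewrite comb_delta; exact: P_mod.
pose P' (v : 'Mod[S]_I) := \sum_(i in J) (v i : S) *: map_mx phi (p i).
have P'_map v : P' (map_vec phi v) = map_mx phi (P v).
  rewrite /P' /P; apply/rowP => k; rewrite summxE mxE summxE rmorph_sum.
  by apply: eq_bigr => i _; rewrite !mxE ffunE rmorphM.
have P'P a u v : P' (a *: u + v) = a *: P' u + P' v.
  rewrite /P' scaler_sumr -big_split; apply: eq_bigr => i _ /=.
  by rewrite !ffunE scalerDl scalerA.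
have P'0 : P' 0 = 0 by apply: big1 => i _; rewrite ffunE scale0r.
have P'_B v : base_change phi B v -> P' v = 0.
  pose K : set 'Mod[S]_I := [set v | P' v = 0].
  apply: (@base_change_min _ _ _ _ _ K) => [|w Bw]; rewrite /K /=.
    by split=> //= a u w u0 w0; rewrite P'P u0 w0 scaler0 addr0.
  by rewrite P'_map P_B // map_mx0.
have P'_comb x : P' (comb x (map_vec phi \o e)) = x.
  have -> : P' (comb x (map_vec phi \o e)) = \sum_k x 0 k *: P' (map_vec phi (e k)).
    by rewrite /comb; elim/big_rec2: _ => [|k w u _ <-]; rewrite ?P'P.
  rewrite [RHS]row_sum_delta; apply: eq_bigr => k _.
  by rewrite P'_map P_e map_delta_mx.
split=> [k|v Cv|x /P'_B]; last by rewrite P'_comb.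
  exact: coord_submodule_map.
exists (P' v).
have -> : v - comb (P' v) (map_vec phi \o e)
    = \sum_(i in J) v i *: map_vec phi (basis_vec R i - comb (p i) e).
  have E i : map_vec phi (basis_vec R i - comb (p i) e)
      = basis_vec S i - comb (map_mx phi (p i)) (map_vec phi \o e).
    rewrite map_vecB map_basis_vec map_vec_sum; congr (_ - _).
    by apply: eq_bigr => k _; rewrite mxE.
  under eq_bigr do rewrite E scalerBr -combZ.
  rewrite sumrB -coord_submodule_expand //; congr (_ - _).
  by rewrite /P'; elim/big_rec2: _ => [|i w x _ <-]; rewrite ?comb0 ?combD.
apply: submodule_sum => [|i Ji]; first exact: base_change_submodule.
apply: submoduleZ; first exact: base_change_submodule.
exact/base_change_map/pP.
Qed.

End CoordinateSubmodule.

Arguments coord_submodule {I} J R _.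
Arguments basis_vec {I} R i.

(** * Locally free quotients and the Grassmannian *)

Section LocallyFreeQuotients.
Variable I : finType.

Definition free_rank_in (R : comPzRingType) (M B : set 'Mod[R]_I) (rk : set nat)
  : property R := fun S phi =>
  exists2 q, rk q & free_quotient (base_change phi M) (base_change phi B) q.

Lemma free_rank_in_comp (R S T : comPzRingType) (phi : {rmorphism R -> S})
    (chi : {rmorphism S -> T}) (M B : set 'Mod[R]_I) rk :
  pull phi (free_rank_in M B rk) chi =
  free_rank_in (base_change phi M) (base_change phi B) rk chi.
Proof. by rewrite /pull /free_rank_in !base_change_comp. Qed.

Lemma coord_submodule_predT (R : comPzRingType) :
  coord_submodule predT R = [set: 'Mod[R]_I].
Proof. by apply/seteqP; split. Qed.

Lemma base_changeT (R S : comPzRingType) (phi : {rmorphism R -> S}) :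
  base_change phi [set: 'Mod[R]_I] = setT.
Proof. by rewrite -!coord_submodule_predT base_change_coord. Qed.

Lemma free_quotient_coord (J : {pred I}) (R : comPzRingType) :
  free_quotient setT (coord_submodule J R) #|[predC J]|.
Proof.
apply/free_quotientP; [exact: submoduleT|exact: coord_submoduleP|].
have combE (x : 'rV[R]_#|[predC J]|) i (Ji : i \in [predC J]) :
    comb x (fun k => basis_vec R (enum_val k)) i = x 0 (enum_rank_in Ji i).
  rewrite /comb sum_ffunE (bigD1 (enum_rank_in Ji i)) //= !ffunE.
  rewrite enum_rankK_in // eqxx big1 => [|k nk].
    by rewrite addr0; apply: mulr1.
  rewrite !ffunE; case: eqP => [ik|_]; last exact: mulr0.
  by case/eqP: nk; rewrite -[LHS](enum_valK_in Ji); congr enum_rank_in.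
exists (fun k => basis_vec R (enum_val k)); split=> // [v _|x Cx].
  exists (\row_k v (enum_val k)) => i Ji; rewrite !ffunE.
  have Ji' : i \in [predC J] by [].
  by rewrite (combE _ _ Ji') mxE enum_rankK_in // subrr.
apply/rowP => k; have Jk := enum_valP k.
by rewrite mxE -[k](enum_valK_in Jk) -combE; apply: Cx; have := Jk; rewrite inE.
Qed.

Lemma free_quotient_full (R : comPzRingType) :
  free_quotient [set: 'Mod[R]_I] [set 0] #|I|.
Proof.
have -> : [set (0 : 'Mod[R]_I)]%classic = coord_submodule pred0 R.
  apply/seteqP; split=> [_ /= -> i _|v Cv]; first by rewrite ffunE.
  by apply/ffunP => i; rewrite Cv // ffunE.
by rewrite -(eq_card (fun _ => erefl) : #|[predC pred0]| = #|I|); apply: free_quotient_coord.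
Qed.

Lemma free_quotient_base_change (J : {pred I}) (R S : comPzRingType)
    (phi : {rmorphism R -> S}) (B : set 'Mod[R]_I) q :
  is_submodule B -> B `<=` coord_submodule J R ->
  free_quotient (coord_submodule J R) B q ->
  free_quotient (coord_submodule J S) (base_change phi B) q.
Proof.
move=> sB BJ /free_quotientP[|//|e be]; first exact: coord_submoduleP.
apply/free_quotientP; first exact: coord_submoduleP.
  exact: base_change_submodule.
by exists (map_vec phi \o e); apply: quotient_basis_base_change.
Qed.

Section Coordinate.
Variables (J : {pred I}) (R : comPzRingType) (B : set 'Mod[R]_I).
Hypothesis BJ : B `<=` coord_submodule J R.

Lemma stable_free_rank_in rk : stable (free_rank_in (coord_submodule J R) B rk).
Proof.
move=> S T phi chi [q rkq]; rewrite base_change_coord => fq; exists q => //.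
rewrite base_change_coord base_change_comp; apply: free_quotient_base_change => //.
  exact: base_change_submodule.
by rewrite -(base_change_coord J phi); apply: base_changeS.
Qed.

Lemma locally_free_quotientP rk :
  locally_free_quotient_in (coord_submodule J R) B rk <->
  covered (free_rank_in (coord_submodule J R) B rk).
Proof.
split=> [|/covered_locally //].
exact/locally_covered/stable_free_rank_in.
Qed.

End Coordinate.

Lemma locally_free_quotientTP (R : comPzRingType) (B : set 'Mod[R]_I) rk :
  locally_free_quotient_in setT B rk <-> covered (free_rank_in setT B rk).
Proof. by rewrite -!coord_submodule_predT; apply: locally_free_quotientP. Qed.

Lemma locally_free_quotient_base_change (J : {pred I}) (R S : comPzRingType)
    (phi : {rmorphism R -> S}) (B : set 'Mod[R]_I) rk :
  is_submodule B -> B `<=` coord_submodule J R ->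
  locally_free_quotient_in (coord_submodule J R) B rk ->
  locally_free_quotient_in (coord_submodule J S) (base_change phi B) rk.
Proof.
move=> sB BJ /(locally_free_quotientP BJ)/covered_pull-/(_ _ phi) cB.
apply: covered_locally; apply: covered_mono cB => T chi.
by rewrite free_rank_in_comp base_change_coord.
Qed.

Lemma locally_free_quotientS (R : comPzRingType) (M B : set 'Mod[R]_I) rk rk' :
  rk `<=` rk' -> locally_free_quotient_in M B rk -> locally_free_quotient_in M B rk'.
Proof.
move=> rkk' [n [f [f1 fP]]]; exists n, f; split=> // k.
by have [S [phi [loc [q /rkk' ? ?]]]] := fP k; exists S, phi; split=> //; exists q.
Qed.

(** [P] is the projection $R^I/B \to R^I/M$ in the bases [e] and [u], and [E] lifts [u] back, so $EP
    = 1$ and [covered_completion] applies. *)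
Lemma covered_free_quotient_ker (R : comPzRingType) (M B : set 'Mod[R]_I) d q :
  is_submodule M -> is_submodule B -> B `<=` M ->
  free_quotient setT M d -> free_quotient setT B q ->
  covered (free_rank_in M B [set r | (r + d)%N = q]).
Proof.
move=> sM sB BM /free_quotientP[//|//|u bu] /free_quotientP[//|//|e be].
have [P PP] := quotient_basis_mx (w := e) bu (fun _ => Logic.I).
have [E EP] := quotient_basis_mx (w := u) be (fun _ => Logic.I).
have EP1 : E *m P = 1%:M.
  apply/row_matrixP => k; rewrite row_mul row1; apply: (quotient_basis_inj sM bu).
  rewrite comb_delta comb_mulmx -(subrKA (comb (row k E) e)).
  apply: submoduleD => //; rewrite -opprB; apply: submoduleN => //.
    by apply: submodule_comb_sub.
  exact: BM.
apply: covered_mono (covered_completion EP1) => S phi.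
move=> [r [rdq [E0 [E' [P' [E'P E'P' PE]]]]]]; exists r => //.
have sM' := base_change_submodule phi M; have sB' := base_change_submodule phi B.
apply/free_quotientP => //.
have bc N p (w : 'I_p -> 'Mod[R]_I) : is_submodule N -> quotient_basis setT N w ->
    quotient_basis setT (base_change phi N) (map_vec phi \o w).
  rewrite -!coord_submodule_predT => sN; apply: quotient_basis_base_change => //.
have PP' k : base_change phi M
    ((map_vec phi \o e) k - comb (row k (map_mx phi P)) (map_vec phi \o u)).
  have -> : (map_vec phi \o e) k - comb (row k (map_mx phi P)) (map_vec phi \o u)
      = map_vec phi (e k - comb (row k P) u).
    rewrite map_vecB map_vec_sum; congr (_ - _).
    by apply: eq_bigr => l _; rewrite !mxE.
  exact: base_change_map.
exists (fun a => comb (row a E') (map_vec phi \o e)).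
apply: (quotient_basis_ker sM' sB' (base_changeS phi BM) (@subsetT _ _)
  (bc _ _ _ sB be) (bc _ _ _ sM bu) PP' E'P E'P' PE).
Qed.

Lemma locally_free_quotient_ker (R : comPzRingType) (M B : set 'Mod[R]_I) d q rk :
  is_submodule M -> is_submodule B -> B `<=` M ->
  locally_free_quotient_in setT M d -> locally_free_quotient_in setT B q ->
  (forall a b c, (a + b)%N = c -> d b -> q c -> rk a) ->
  locally_free_quotient_in M B rk.
Proof.
move=> sM sB BM lM lB rkP.
move: lM lB => /locally_free_quotientTP cM /locally_free_quotientTP cB.
apply/covered_locally/covered_trans.
apply: covered_mono (covered_and cM cB) => S phi.
move=> [[b db fM] [c qc fB]].
have sM' := base_change_submodule phi M; have sB' := base_change_submodule phi B.
rewrite !base_changeT in fM fB.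
apply: covered_mono (covered_free_quotient_ker sM' sB' (base_changeS phi BM) fM fB).
move=> T chi [a /= abc fa]; rewrite free_rank_in_comp; exists a => //.
exact: rkP db qc.
Qed.

Lemma free_quotient_cat (R : comPzRingType) (V : lmodType R) (M' M B : set V) q d :
  is_submodule M' -> is_submodule M -> is_submodule B -> B `<=` M -> M `<=` M' ->
  free_quotient M B q -> free_quotient M' M d -> free_quotient M' B (q + d).
Proof.
move=> sM' sM sB BM MM' /free_quotientP[//|//|e be] /free_quotientP[//|//|u bu].
by apply/free_quotientP => //; eexists; apply: quotient_basis_cat be bu.
Qed.

Lemma free_quotient_rank (R : comPzRingType) (V : lmodType R) (M B : set V) p q :
  is_submodule M -> is_submodule B ->
  free_quotient M B p -> free_quotient M B q -> p = q \/ (1 : R) = 0.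
Proof.
move=> sM sB /free_quotientP[//|//|e be] /free_quotientP[//|//|w bw].
exact: quotient_basis_rank be bw.
Qed.

(** Injectivity survives because localization is flat. A general base change would not do:
    $2\mathbb{Z}$ is free of rank one, but its span in $\mathbb{F}_2$ is $0$. *)
Lemma free_localization (R S : comPzRingType) (phi : {rmorphism R -> S}) (f : R)
    (V : set 'Mod[R]_I) r :
  is_localization phi f -> is_submodule V -> free_quotient V [set 0] r ->
  free_quotient (base_change phi V) [set 0] r.
Proof.
move=> loc sV /free_quotientP[//||e [Ve eS eI]]; first exact: submodule_set0.
have [[y fy] _ kerP] := loc.
apply/free_quotientP; [exact: base_change_submodule|exact: submodule_set0|].
have map_comb x : comb (map_mx phi x) (map_vec phi \o e) = map_vec phi (comb x e).
  by rewrite map_vec_sum; apply: eq_bigr => k _; rewrite mxE.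
exists (map_vec phi \o e); split=> [k||x].
- exact: base_change_map.
- pose C := [set v | exists x, v - comb x (map_vec phi \o e) = 0].
  apply: (@base_change_min _ _ _ _ _ C) => [|v Vv].
    split=> [|a u v [x /subr0_eq Ex] [z /subr0_eq Ez]].
      by exists 0; rewrite comb0 subr0.
    by exists (a *: x + z); rewrite combD combZ -Ex -Ez subrr.
  have [x /subr0_eq Ex] := eS _ Vv.
  by exists (map_mx phi x); rewrite map_comb -Ex subrr.
(* Clear the denominators of [x], viewed as a vector of $S^r$. *)
- have [n [w [_ Ew]]] : exists n (w : 'Mod[R]_'I_r), [set: 'Mod[R]_'I_r] w /\
      phi f ^+ n *: [ffun k => x 0 k : S^o] = map_vec phi w.
    apply: base_change_localization => //.
    by rewrite -[setT](_ : coord_submodule predT R = _) ?base_change_coord //; apply/seteqP.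
  have xE : phi f ^+ n *: x = map_mx phi (\row_k w k).
    apply/rowP => k; have /ffunP/(_ k) := Ew.
    by rewrite !mxE !ffunE.
  move=> /= x0.
  have /choice[m mP] i : exists m, f ^+ m * comb (\row_k w k) e i = 0.
    apply: kerP; have : map_vec phi (comb (\row_k w k) e) = 0.
      by rewrite -map_comb -xE combZ x0 scaler0.
    by move/ffunP => /(_ i); rewrite !ffunE.
  pose N := (\sum_i m i)%N.
  have : f ^+ N *: \row_k w k = 0.
    apply: eI; rewrite /= combZ; apply/ffunP => i; rewrite !ffunE.
    rewrite /N (bigD1 i) //= addnC exprD /GRing.scale /= -mulrA.
    by rewrite mP mulr0.
  move=> /(congr1 (map_mx phi)); rewrite map_mxZ -xE map_mx0 rmorphXn scalerA -exprD.
  move=> /(congr1 (fun z => y ^+ (N + n) *: z)).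
  by rewrite scalerA mulrC -exprMn fy expr1n scale1r scaler0.
Qed.

End LocallyFreeQuotients.

(** Locally the ranks of $V$ and $R^N/V$ add up to $N$; conversely $V$ is the kernel of $R^N \to
    R^N/V$, hence locally free. *)
Lemma GrassmannianE N (R : comPzRingType) r (V : set 'Mod[R]_'I_N) :
  Grassmannian r N R V <->
  is_submodule V /\ locally_free_quotient setT V (N%:Z - r).
Proof.
split=> [[sV lV lT]|[sV lT]]; split=> //.
- apply: covered_locally; apply: locally_covered_trans.
  have [n [f [f1 fP]]] := lV; exists n, f; split=> // k.
  have [S [phi [loc [r' rr' fV]]]] := fP k; exists S, phi; split=> //.
  rewrite base_change_set0 in fV.
  have [p [h [h1 hP]]] := covered_locally (covered_pull phi (iffLR (locally_free_quotientTP _ _) lT)).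
  apply: locally_covered_trans; exists p, h; split=> // l.
  have [T [chi [loc' [q _]]]] := hP l; rewrite base_changeT => fT.
  exists T, chi; split=> //.
  have sV' := base_change_submodule (chi \o phi) V.
  have fV' : free_quotient (base_change (chi \o phi) V) [set 0] r'.
    rewrite base_change_comp; apply: (free_localization loc') => //.
    exact: base_change_submodule.
  have fN := free_quotient_full 'I_N T; rewrite card_ord in fN.
  have V0 : [set 0] `<=` base_change (chi \o phi) V.
    by move=> _ ->; apply: submodule0.
  have f0 := free_quotient_cat (submoduleT _) sV' (submodule_set0 _) V0 (@subsetT _ _)
    fV' fT.
  (* Over the zero ring ranks cannot be compared, but every property is covered there. *)
  have [E|T0] := free_quotient_rank (submoduleT _) (submodule_set0 _) f0 fN;
    last exact: covered_zero.
  rewrite pull_comp; apply: covered_everywhere => U psi.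
  rewrite free_rank_in_comp base_changeT; exists q.
    by move: rr' => /= <-; rewrite -E; lia.
  rewrite -!coord_submodule_predT base_change_coord.
  by apply: free_quotient_base_change => //; rewrite coord_submodule_predT.
- have fN : locally_free_quotient_in [set: 'Mod[R]_'I_N] [set 0] [set N].
    apply: covered_locally; apply: covered_everywhere => S phi.
    exists N => //; rewrite base_changeT base_change_set0.
    by have := free_quotient_full 'I_N S; rewrite card_ord.
  apply: (locally_free_quotient_ker sV (submodule_set0 _) _ lT fN) => [_ ->|].
    exact: submodule0.
  by move=> a b c /= <-; lia.
- exact: locally_free_quotientS lT.
Qed.

(** * The spine algebra *)

Local Arguments Acoef : simpl never.

Section Spine.
Variables (m : nat) (c : 'I_m -> nat).
Hypothesis c_gt0 : forall i, (0 < c i)%N.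

Definition in_tail : pred (Abasis c) := fun b =>
  if b is Some (existT i j) then (uphalf (c i) <= j.+1)%N else false.

Definition in_spine : pred (Abasis c) := fun b => (b == None) || in_tail b.

Lemma AcoefE (R : comPzRingType) (x : Aplus c R) i (j : 'I_(c i).-1) :
  Acoef x i j.+1 = x (Amon j).
Proof. by rewrite /Acoef; case: insubP => [k _ /val_inj ->|]; rewrite ?ltn_ord. Qed.

Lemma basis_vec_None (R : comPzRingType) : basis_vec R None = 1 :> Aplus c R.
Proof. by apply/ffunP => b; rewrite !ffunE. Qed.

Lemma one_in_spine (R : comPzRingType) : coord_submodule in_spine R (1 : Aplus c R).
Proof. by rewrite -basis_vec_None; apply: coord_submodule_basis. Qed.

Lemma uphalf_gt0 i : exists u, uphalf (c i) = u.+1.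
Proof. by exists (uphalf (c i)).-1; rewrite prednK // uphalf_half; have := c_gt0 i; lia. Qed.

Lemma Aspine_coord : @Aspine m c = coord_submodule in_spine int.
Proof.
apply/seteqP; split=> [_ [n [a ->]]|x Cx].
  have sC := coord_submoduleP in_spine int.
  apply: (@submoduleD int (Aplus c int) _ _ _ sC) => //.
    rewrite -scaler_int; apply: (@submoduleZ int (Aplus c int) _ _ _ sC) => //.
    exact: one_in_spine.
  apply: (@submodule_sum int (Aplus c int) _ _ _ _ _ sC) => // i _.
  have [u Eu] := uphalf_gt0 i.
  move=> [[i' j] Jj|//]; rewrite -[LHS]/(_ (Amon j)) -AcoefE.
  rewrite AcoefM ?ltn_ord // big1 // => e _.
  rewrite Eu Acoef_genX; last by have := ltn_ord j; lia.
  case: eqP => [Ei|]; last by rewrite mulr0.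
  case: eqP => [Ej|]; last by rewrite mulr0.
  have Eu' : uphalf (c i') = u.+1 by rewrite Ei.
  by move: Jj; rewrite unfold_in /= Eu' -Ej; lia.
(* The multiplier $a_i$ is the $t_i$-part of $x$ divided by $t_i^{\lceil c_i/2 \rceil}$. *)
exists (x None), (fun i => \sum_(j < (c i).-1 | (uphalf (c i) <= j.+1)%N)
  (x (Amon j) : int) *: @Agen m c int i ^+ (j.+1 - uphalf (c i))).
rewrite {1}[x]Aplus_expand -[(x None)%:~R]scaler_int; congr (_ + _).
  by rewrite intz.
apply: eq_bigr => i _; rewrite mulr_suml (bigID (fun j : 'I_ _ => uphalf (c i) <= j.+1)%N) /=.
rewrite [X in _ + X]big1 ?addr0 => [|j Jj]; last by rewrite Cx ?scale0r.
by apply: eq_bigr => j uj; rewrite -AscaleAl -exprD subnK.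
Qed.

(** This is $(x - x_0)(y - y_0) = 0$ expanded; the product is thus a linear combination of $x$, $y$
    and $1$. *)
Lemma spine_mul (R : comPzRingType) (x y : Aplus c R) :
  coord_submodule in_spine R x -> coord_submodule in_spine R y ->
  x * y = (x None : R) *: y + (y None : R) *: x - (x None * y None : R) *: (1 : Aplus c R).
Proof.
have coef0 (z : Aplus c R) i e : coord_submodule in_spine R z ->
    (0 < e < uphalf (c i))%N -> Acoef z i e = 0.
  move=> Cz /andP[e0 eu]; case: e e0 eu => // e _ eu.
  rewrite /Acoef; case: insubP => // j _ Ej; apply: Cz.
  by rewrite unfold_in /= Ej -ltnNge.
move=> Cx Cy; apply/ffunP => -[[i j]|]; last first.
  rewrite AmulNone !ffunE /GRing.scale /= mulr1.
  by rewrite [y None * _]mulrC addrK.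
rewrite -[LHS]/((x * y) (Amon j)) -AcoefE AcoefM ?ltn_ord //.
rewrite big_ord_recl big_ord_recr big1 => [|e _]; last first.
  have lt_e := ltn_ord e; have lt_j := ltn_ord j.
  rewrite /= /bump /= add1n.
  (* The two positive exponents add up to $j + 1 < c_i$, so one of them is below $\lceil c_i/2
     \rceil$. *)
  have [lt_eu|le_ue] := ltnP e.+1 (uphalf (c i)).
    by rewrite coef0 ?mul0r ?lt_eu //.
  rewrite [X in _ * X]coef0 ?mulr0 //.
  by have := half_leq le_ue; have := odd_double_half (c i); rewrite uphalf_half in le_ue *; lia.
rewrite /= /bump /= add1n subn0 subnn add0r !AcoefE !ffunE /GRing.scale /=.
by rewrite mulr0 subr0; congr (_ + _); rewrite mulrC.
Qed.

Lemma spine_subalgebra (R : comPzRingType) (B : set (Aplus c R)) :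
  is_submodule B -> B 1 -> B `<=` coord_submodule in_spine R -> is_subalgebra B.
Proof.
move=> sB B1 BC; split=> // x y Bx By.
rewrite (spine_mul (BC _ Bx) (BC _ By)).
by apply: submoduleB => //; first apply: submoduleD => //; apply: submoduleZ.
Qed.

Lemma map_vec_mul (R S : comPzRingType) (phi : {rmorphism R -> S}) (x y : Aplus c R) :
  map_vec phi (x * y) = (map_vec phi x : Aplus c S) * (map_vec phi y : Aplus c S).
Proof.
have E (z : Aplus c R) i e : Acoef (map_vec phi z : Aplus c S) i e = phi (Acoef z i e).
  by rewrite /Acoef; case: e => [|e]; [|case: insub => [j|]]; rewrite ?ffunE ?rmorph0.
apply: AcoefP => [|i e le_e]; first by rewrite AmulNone !ffunE rmorphM.
rewrite E !AcoefM // rmorph_sum.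
by apply: eq_bigr => a _; rewrite rmorphM !E.
Qed.

Lemma map_vec_one (R S : comPzRingType) (phi : {rmorphism R -> S}) :
  map_vec phi (1 : Aplus c R) = (1 : Aplus c S).
Proof. by rewrite -!basis_vec_None map_basis_vec. Qed.

Lemma base_change_subalgebra (R S : comPzRingType) (phi : {rmorphism R -> S})
    (B : set (Aplus c R)) :
  is_subalgebra B -> @is_subalgebra m c S (base_change phi B).
Proof.
move=> [sB B1 BM]; have sB' := base_change_submodule phi B; split=> //.
  by rewrite -(map_vec_one phi); apply: base_change_map.
(* Closure under products is linear in each factor, so the two factors are reduced to images of
   elements of [B] in turn. *)
pose D := [set x : Aplus c S | forall y : Aplus c S,
  base_change phi B y -> base_change phi B (x * y)].
move=> x y Bx; move: x Bx y; apply: (@base_change_min _ _ _ _ _ D).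
  split=> [y _|a u v Du Dv y By]; first by rewrite mul0r; apply: submodule0.
  rewrite mulrDl -AscaleAl; apply: submoduleD => //.
    by apply: submoduleZ => //; apply: Du.
  exact: Dv.
move=> u Bu y; move: y.
pose D' := [set y : Aplus c S | base_change phi B ((map_vec phi u : Aplus c S) * y)].
apply: (@base_change_min _ _ _ _ _ D') => [|v Bv]; last first.
  by rewrite /D' /= -map_vec_mul; apply/base_change_map/BM.
split=> [|a w w' Dw Dw']; rewrite /D' /=; first by rewrite mulr0; apply: submodule0.
rewrite mulrC mulrDl -AscaleAl; apply: submoduleD => //; last by rewrite mulrC.
by apply: submoduleZ => //; rewrite mulrC.
Qed.

Lemma territoryE (J : {pred Abasis c}) (A' : set (Aplus c int)) g
    (R : comPzRingType) (B : set (Aplus c R)) :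
  A' = coord_submodule J int ->
  territory A' g B <->
  [/\ is_subalgebra B, B `<=` coord_submodule J R &
      locally_free_quotient (coord_submodule J R) B g].
Proof. by move=> ->; rewrite /territory /= base_change_coord. Qed.

Lemma territory_functor (J : {pred Abasis c}) (A' : set (Aplus c int)) g :
  A' = coord_submodule J int -> is_functor (territory A' g).
Proof.
move=> A'J R S phi B /(territoryE _ _ A'J)[aB BJ lB].
apply/(territoryE _ _ A'J); split; first exact: base_change_subalgebra.
  by rewrite -(base_change_coord J phi); apply: base_changeS.
by apply: locally_free_quotient_base_change => //; case: aB.
Qed.

End Spine.

(** * Closedness of the spine and the count of monomials *)

Section SpineGrassmannian.
Variables (m : nat) (c : 'I_m -> nat).
Hypothesis c_gt0 : forall i, (0 < c i)%N.
Local Notation C := (coord_submodule (@in_spine m c)).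

(** [corank] picks some rank by choice; its value is forced by invariance of rank over the nonzero
    ring $\mathbb{Z}$. *)
Lemma corank_Aspine : corank (@Aspine m c) = #|[predC @in_spine m c]|.
Proof.
rewrite /corank (Aspine_coord c_gt0).
have fC := free_quotient_coord (@in_spine m c) int.
have [//|] := free_quotient_rank (submoduleT _) (coord_submoduleP _ _)
  (xgetPex 0%N (ex_intro _ _ fC)) fC.
by move=> /eqP; rewrite oner_eq0.
Qed.

Lemma TerE g (R : comPzRingType) (B : set (Aplus c R)) :
  Ter c g R B <-> is_subalgebra B /\ locally_free_quotient setT B g.
Proof.
rewrite /Ter (territoryE _ _ (esym (coord_submodule_predT _ _))).
by rewrite coord_submodule_predT; split=> [[]|[]].
Qed.

Lemma SpineE g (R : comPzRingType) (B : set (Aplus c R)) :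
  Spine c g R B <-> [/\ is_subalgebra B, B `<=` C R &
    locally_free_quotient (C R) B (g - #|[predC @in_spine m c]|%:Z)].
Proof. by rewrite /Spine corank_Aspine (territoryE _ _ (Aspine_coord c_gt0)). Qed.

Lemma Spine_closed g : closed_subscheme (Spine c g) (Ter c g).
Proof.
split.
- exact: territory_functor (esym (coord_submodule_predT _ _)).
- exact: territory_functor (Aspine_coord c_gt0).
- move=> R B /SpineE[aB BC [n [f [f1 fP]]]]; apply/TerE; split=> //.
  exists n, f; split=> // k; have [S [phi [loc [q qg fq]]]] := fP k.
  exists S, phi; split=> //; exists (q + #|[predC @in_spine m c]|)%N.
    by move: qg => /=; lia.
  have BC' := base_changeS phi BC; rewrite base_changeT.
  rewrite base_change_coord in fq BC'.
  apply: free_quotient_cat fq (free_quotient_coord _ _) => //.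
  + exact: coord_submoduleP.
  + exact: base_change_submodule.
(* The ideal is generated by the off-spine coordinates of the elements of [B]; [phi] kills it
   exactly when the base change of [B] lies in the spine algebra. *)
- move=> R B TB; pose X : set R^o := [set x | exists b i, [/\ B b, i \notin @in_spine m c & x = b i]].
  exists (span X); split=> [|S phi]; first exact: span_submodule.
  have kerX : (forall x, span X x -> phi x = 0) <-> base_change phi B `<=` C S.
    split=> [JX|BC x].
      apply: base_change_min => [|b Bb i ni]; first exact: coord_submoduleP.
      by rewrite ffunE; apply: JX; apply: sub_span; exists b, i.
    pose K : set R^o := [set x | phi x = 0].
    move: x; apply: (@span_min R R^o X K) => [|_ [b [i [Bb ni ->]]]].
      split=> [|a u v Ku Kv]; rewrite /K /=; first exact: rmorph0.
      by rewrite rmorphD rmorphM Ku Kv mulr0 addr0.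
    have := BC _ (base_change_map phi Bb) i ni.
    by rewrite ffunE.
  rewrite kerX; split=> [/SpineE[]//|BC].
  have [aB lB] := iffLR (TerE _ _)
    (territory_functor (esym (coord_submodule_predT _ _)) phi TB).
  apply/SpineE; split=> //; have [sB _ _] := aB.
  (* The whole algebra modulo the spine algebra is free of rank $\delta$, so the kernel lemma lowers
     the rank from $g$ to $g - \delta$. *)
  have lC : locally_free_quotient_in setT (C S) [set #|[predC @in_spine m c]|].
    apply: covered_locally; apply: covered_everywhere => T chi.
    exists #|[predC @in_spine m c]| => //.
    by rewrite base_changeT base_change_coord; apply: free_quotient_coord.
  apply: (locally_free_quotient_ker (coord_submoduleP _ _) sB BC lC lB).
  by move=> a _ q <- -> /=; lia.
Qed.

Lemma card_option_pred (T : finType) (P : pred T) :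
  #|[pred o : option T | if o is Some t then P t else false]| = #|P|.
Proof.
have Si : injective (@Some T) by move=> t t' [].
rewrite -(card_image Si P); apply: eq_card => -[t|]; rewrite !inE.
  by rewrite mem_map ?mem_enum.
by apply/esym/negbTE/mapP => -[].
Qed.

Lemma card_tail : #|@in_tail m c| = (\sum_i (c i)./2)%N.
Proof.
pose P := [pred t : {i : 'I_m & 'I_(c i).-1} | (uphalf (c (tag t)) <= (tagged t).+1)%N].
have -> : #|@in_tail m c| = #|P|.
  by rewrite -(card_option_pred P); apply: eq_card => -[[i j]|].
rewrite -sum1_card.
have := sig_big_dep (op := addn) (fun _ => true)
  (fun i (j : 'I_(c i).-1) => (uphalf (c i) <= j.+1)%N) (fun _ _ => 1%N).
rewrite /= => <-; apply: eq_bigr => i _.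
(* Index [j] means exponent $j + 1$, so the tail indices run from $\lceil c_i/2 \rceil - 1$ to $c_i
   - 2$. *)
have [u Eu] := uphalf_gt0 c_gt0 i; rewrite Eu.
have := big_geq_mkord (op := addn) u (c i).-1 predT (fun=> 1%N).
rewrite /= => <-; rewrite sum_nat_const_nat muln1.
by rewrite uphalf_half in Eu; have := odd_double_half (c i); lia.
Qed.

Lemma card_in_spine : #|@in_spine m c| = #|@in_tail m c|.+1.
Proof.
rewrite (cardD1 None) (eq_card (B := @in_tail m c)) => [//|b].
by rewrite !inE; case: b.
Qed.

(** The algebra has rank $c - m + 1$ and the spine algebra $1 + \sum_i \lfloor c_i/2 \rfloor$; the
    difference is $\delta$. *)
Lemma card_spineC :
  (#|[predC @in_spine m c]| + \sum_i (c i)./2 + m = \sum_i c i)%N.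
Proof.
have := cardC (@in_spine m c).
rewrite card_option card_tagged sumnE big_map big_enum card_in_spine card_tail /=.
have -> : (\sum_i c i = \sum_(i < m) #|'I_(c i).-1| + m)%N.
  rewrite -[X in (_ + X)%N](card_ord m) -sum1_card -big_split.
  by apply: eq_bigr => i _; rewrite card_ord /= addn1 prednK.
by move=> /= [<-]; lia.
Qed.

End SpineGrassmannian.

(** * The spine as a Grassmannian *)

Section SpineIso.
Variables (m : nat) (c : 'I_m -> nat).
Hypothesis c_gt0 : forall i, (0 < c i)%N.
Local Notation C := (coord_submodule (@in_spine m c)).
Variable N : nat.
Hypothesis card_tailN : #|@in_tail m c| = N.

(** The cast allows $N$ to be the sum $\sum_i \lfloor c_i/2 \rfloor$, which equals the cardinal only
    by a proof. *)
Definition tail_index (k : 'I_N) : Abasis c :=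
  enum_val (cast_ord (esym card_tailN) k).

Lemma tail_index_inj : injective tail_index.
Proof. by move=> k l /enum_val_inj/cast_ord_inj. Qed.

Lemma tail_index_in k : in_tail (tail_index k).
Proof. exact: (enum_valP (cast_ord _ k)). Qed.

Lemma tail_index_onto b : in_tail b -> exists k, tail_index k = b.
Proof.
move=> tb; exists (cast_ord card_tailN (enum_rank_in tb b)).
by rewrite /tail_index cast_ordK enum_rankK_in.
Qed.

Section Points.
Variable R : comPzRingType.

Definition tail_part (v : 'Mod[R]_(Abasis c)) : 'Mod[R]_'I_N :=
  [ffun k => v (tail_index k)].

Definition of_tail (w : 'Mod[R]_'I_N) : 'Mod[R]_(Abasis c) :=
  \sum_k w k *: basis_vec R (tail_index k).

Lemma tail_partP a u v : tail_part (a *: u + v) = a *: tail_part u + tail_part v.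
Proof. by apply/ffunP => k; rewrite !ffunE. Qed.

Lemma tail_partB u v : tail_part (u - v) = tail_part u - tail_part v.
Proof. by apply/ffunP => k; rewrite !ffunE. Qed.

Lemma tail_part0 : tail_part 0 = 0.
Proof. by apply/ffunP => k; rewrite !ffunE. Qed.

Lemma tail_part_sum q (x : 'I_q -> R) (e : 'I_q -> 'Mod[R]_(Abasis c)) :
  tail_part (\sum_k x k *: e k) = \sum_k x k *: tail_part (e k).
Proof. by elim/big_rec2: _ => [|k u v _ <-]; rewrite ?tail_part0 ?tail_partP. Qed.

Lemma of_tailP a u v : of_tail (a *: u + v) = a *: of_tail u + of_tail v.
Proof.
rewrite /of_tail scaler_sumr -big_split; apply: eq_bigr => k _ /=.
by rewrite !ffunE scalerDl scalerA.
Qed.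

Lemma of_tail0 : of_tail 0 = 0.
Proof. by apply: big1 => k _; rewrite ffunE scale0r. Qed.

Lemma of_tail_spine w : C R (of_tail w).
Proof.
have sC := coord_submoduleP (@in_spine m c) R.
apply: (submodule_sum _ sC) => k _; apply: (submoduleZ _ sC).
by apply: coord_submodule_basis; rewrite unfold_in /in_spine tail_index_in orbT.
Qed.

Lemma of_tailK w : tail_part (of_tail w) = w.
Proof.
apply/ffunP => k; rewrite !ffunE sum_ffunE (bigD1 k) //= !ffunE eqxx big1 => [|l nlk].
  by rewrite addr0; apply: mulr1.
by rewrite !ffunE (inj_eq tail_index_inj) eq_sym (negPf nlk); apply: mulr0.
Qed.

Lemma spine_expand v : C R v -> v = v None *: basis_vec R None + of_tail (tail_part v).
Proof.
have tNone w : of_tail w None = 0.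
  rewrite /of_tail sum_ffunE big1 // => k _; rewrite !ffunE.
  by case: eqP (tail_index_in k) => [<-//|_ _]; apply: mulr0.
move=> Cv; apply/ffunP => b; rewrite ffunE.
have [tb|ntb] := boolP (in_tail b); last first.
  case: b ntb => [t|_]; last by rewrite tNone !ffunE /GRing.scale /= mulr1 addr0.
  move=> nt; have ns : Some t \notin @in_spine m c by [].
  by rewrite Cv // of_tail_spine // !ffunE addr0; apply/esym/mulr0.
have [k kb] := tail_index_onto tb.
have /ffunP/(_ k) := of_tailK (tail_part v).
rewrite !ffunE kb => ->; case: eqP tb => [->//|_ _].
by rewrite -[LHS]add0r; congr (_ + _); apply/esym/mulr0.
Qed.

Definition spine_of (V : set 'Mod[R]_'I_N) : set 'Mod[R]_(Abasis c) :=
  [set v | C R v /\ V (tail_part v)].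

(** An intersection with the span of the tail monomials; for $B$ inside the spine algebra and
    containing $1$ it is also the projection of $B$. *)
Definition tail_of (B : set 'Mod[R]_(Abasis c)) : set 'Mod[R]_'I_N :=
  [set w | B (of_tail w)].

Lemma spine_of_submodule V : is_submodule V -> is_submodule (spine_of V).
Proof.
move=> sV; have sC := coord_submoduleP (@in_spine m c) R.
split=> [|a u v [Cu Vu] [Cv Vv]].
  by split; [exact: (submodule0 sC)|rewrite tail_part0; apply: submodule0].
by split; [case: sC => _; apply|rewrite tail_partP; case: sV => _; apply].
Qed.

Lemma spine_of_one V : is_submodule V -> spine_of V (basis_vec R None).
Proof.
move=> sV; split; first exact: coord_submodule_basis.
suff -> : tail_part (basis_vec R None) = 0 by apply: submodule0.
by apply/ffunP => k; rewrite !ffunE; case: eqP (tail_index_in k) => // ->.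
Qed.

Lemma tail_of_submodule B : is_submodule B -> is_submodule (tail_of B).
Proof.
move=> sB; split=> [|a u v Bu Bv]; rewrite /tail_of /= ?of_tail0.
  exact: submodule0.
by rewrite of_tailP; case: sB => _; apply.
Qed.

Lemma spine_ofK V : tail_of (spine_of V) = V.
Proof.
apply/seteqP; split=> w; rewrite /tail_of /spine_of /= of_tailK; first by case.
by move=> Vw; split=> //; apply: of_tail_spine.
Qed.

Lemma tail_ofK B : is_submodule B -> B (basis_vec R None) -> B `<=` C R ->
  spine_of (tail_of B) = B.
Proof.
move=> sB B1 BC; apply/seteqP; split=> v.
  move=> [Cv Bv]; rewrite (spine_expand Cv); apply: (submoduleD sB) => //.
  exact: submoduleZ.
move=> Bv; have Cv := BC _ Bv; split=> //; rewrite /tail_of /=.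
have -> : of_tail (tail_part v) = v - v None *: basis_vec R None.
  by rewrite {2}(spine_expand Cv) addrC addKr.
by apply: submoduleB => //; apply: submoduleZ.
Qed.

(** Membership in [spine_of V] ignores the constant term, so $(R \cdot 1 \oplus R^N)/(R \cdot 1
    \oplus V) = R^N/V$; bases move along [tail_part] and [of_tail]. *)
Lemma free_quotient_spine_of V q : is_submodule V ->
  free_quotient (C R) (spine_of V) q <-> free_quotient setT V q.
Proof.
move=> sV; have sC := coord_submoduleP (@in_spine m c) R.
split=> -[e [eM eP]].
  exists (tail_part \o e); split=> // w _.
  have [x [[_ Vx] xU]] := eP _ (of_tail_spine w).
  exists x; rewrite tail_partB of_tailK tail_part_sum in Vx; split=> // y Vy.
  apply: xU; split; last by rewrite tail_partB of_tailK tail_part_sum.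
  apply: (submoduleB sC); first exact: of_tail_spine.
  by apply: (submodule_sum _ sC) => k _; apply: (submoduleZ _ sC).
exists (of_tail \o e); split=> [k|v Cv]; first exact: of_tail_spine.
have E (x : {ffun 'I_q -> R}) :
    tail_part (v - \sum_k x k *: (of_tail \o e) k) = tail_part v - \sum_k x k *: e k.
  rewrite tail_partB tail_part_sum; congr (_ - _).
  by apply: eq_bigr => k _; rewrite /= of_tailK.
have [x [Vx xU]] := eP (tail_part v) Logic.I.
exists x; split=> [|y [_ Vy]]; last by apply: xU; rewrite -E.
split; last by rewrite E.
apply: (submoduleB sC) => //.
by apply: (submodule_sum _ sC) => k _; apply: (submoduleZ _ sC); apply: of_tail_spine.
Qed.

End Points.

Lemma map_of_tail (R S : comPzRingType) (phi : {rmorphism R -> S}) w :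
  map_vec phi (of_tail w) = of_tail (map_vec phi w).
Proof.
by rewrite map_vec_sum; apply: eq_bigr => k _; rewrite ffunE map_basis_vec.
Qed.

Lemma map_tail_part (R S : comPzRingType) (phi : {rmorphism R -> S}) v :
  map_vec phi (tail_part v) = tail_part (map_vec phi v).
Proof. by apply/ffunP => k; rewrite !ffunE. Qed.

Lemma base_change_spine_of (R S : comPzRingType) (phi : {rmorphism R -> S}) V :
  is_submodule V ->
  base_change phi (spine_of V) = spine_of (base_change phi V).
Proof.
move=> sV; have sV' := base_change_submodule phi V.
apply/seteqP; split.
  apply: base_change_min => [|v [Cv Vv]]; first exact: spine_of_submodule.
  split; first exact: coord_submodule_map.
  by rewrite -map_tail_part; apply: base_change_map.
move=> v [Cv Vv]; rewrite (spine_expand Cv).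
apply: submoduleD; first exact: base_change_submodule.
  apply: submoduleZ; first exact: base_change_submodule.
  by rewrite -(map_basis_vec phi); apply/base_change_map/spine_of_one.
move: {v Cv} (tail_part v) Vv.
apply: (@base_change_min _ _ _ _ _ (tail_of (base_change phi (spine_of V)))).
  exact/tail_of_submodule/base_change_submodule.
move=> w Vw; rewrite /tail_of /= -map_of_tail; apply: base_change_map.
by split; [exact: of_tail_spine|rewrite of_tailK].
Qed.

Lemma Spine_spine_of (g : int) (R : comPzRingType) (V : set 'Mod[R]_'I_N) :
  is_submodule V ->
  Spine c g R (spine_of V) <->
  Grassmannian ((\sum_i c i)%N%:Z - m%:Z - g) N R V.
Proof.
move=> sV; rewrite SpineE // GrassmannianE.
have -> : N%:Z - ((\sum_i c i)%N%:Z - m%:Z - g) = g - #|[predC @in_spine m c]|%:Z.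
  by have := card_spineC c_gt0; rewrite -(card_tail c_gt0) card_tailN; lia.
have lE : locally_free_quotient (C R) (spine_of V) (g - #|[predC @in_spine m c]|%:Z)
    <-> locally_free_quotient setT V (g - #|[predC @in_spine m c]|%:Z).
  split=> -[n [f [f1 fP]]]; exists n, f; split=> // k;
    have [S [phi [loc [q qg fq]]]] := fP k; exists S, phi; split=> //; exists q => //.
    rewrite base_change_coord base_change_spine_of // in fq.
    rewrite base_changeT; apply/free_quotient_spine_of => //.
    exact: base_change_submodule.
  rewrite base_changeT in fq; rewrite base_change_coord base_change_spine_of //.
  by apply/free_quotient_spine_of => //; apply: base_change_submodule.
split=> [[_ _ /lE]//|[_ /lE lV]]; split=> //; last by move=> v [].
apply: spine_subalgebra; first exact: spine_of_submodule.
  by rewrite -basis_vec_None; apply: spine_of_one.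
by move=> v [].
Qed.

Lemma Spine_tail_of (g : int) (R : comPzRingType) (B : set (Aplus c R)) :
  Spine c g R B -> is_submodule (@tail_of R B) /\ spine_of (@tail_of R B) = B.
Proof.
move=> /(SpineE c_gt0)[[sB B1 _] BC _]; split; first exact: tail_of_submodule.
by apply: tail_ofK => //; rewrite basis_vec_None.
Qed.

Lemma Grassmannian_functor r M : is_functor (Grassmannian r M).
Proof.
move=> R S phi V /GrassmannianE[sV lV]; apply/GrassmannianE.
split; first exact: base_change_submodule.
rewrite -coord_submodule_predT; apply: locally_free_quotient_base_change => //.
by rewrite coord_submodule_predT.
Qed.

Lemma Spine_isomorphic (g : int) :
  isomorphic_schemes (Spine c g)
    (Grassmannian ((\sum_i c i)%N%:Z - m%:Z - g) N).
Proof.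
split; [by have [] := Spine_closed c_gt0 g|exact: Grassmannian_functor|].
exists tail_of; split=> [R|R S phi B /Spine_tail_of[sV <-]]; last first.
  by rewrite base_change_spine_of // !spine_ofK.
split.
- move=> B SB; have [sV BE] := Spine_tail_of SB.
  by apply/Spine_spine_of => //; rewrite BE.
- move=> B B' /[!inE] /Spine_tail_of[_ BE] /Spine_tail_of[_ BE'] E.
  by rewrite -BE -BE' E.
- move=> V GV; exists (spine_of V); last exact: spine_ofK.
  by apply/Spine_spine_of => //; case: GV.
Qed.

End SpineIso.

Theorem theorem1p3 (m : nat) (c : 'I_m -> nat) (g : nat)
    (hc : forall i, (0 < c i)%N) :
  closed_subscheme (Spine c g) (Ter c g) /\
  isomorphic_schemes (Spine c g)
    (Grassmannian ((\sum_i c i)%N%:Z - m%:Z - g%:Z) (\sum_i (c i)./2)%N).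
Proof. by split; [exact: Spine_closed|exact: Spine_isomorphic (card_tail hc) _]. Qed.
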